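(* $\mathsf{CNOT}$ is a discrete inverse category.
   Context: $\mathsf{CNOT}$ is the strict symmetric monoidal category whose objects are the natural numbers $n$, with $n\otimes m=n+m$, generated by $\mathsf{cnot}:2\to 2$, $|1\rangle:0\to 1$, $\langle 1|:1\to 0$ (and the symmetry $\sigma:2\to2$), subject exactly to the identities below. Composition is diagrammatic ($fg$ = first $f$ then $g$). On $k$ wires numbered $1..k$ top to bottom, $C_{i\to j}$ is the $\mathsf{cnot}$ gate with control wire $i$ and target wire $j$ ($\mathsf{cnot}$ has control on its first wire). Identities: (CNT.1) $C_{1\to2}C_{2\to1}C_{1\to2}=\sigma$; (CNT.2) $C_{1\to2}C_{1\to2}=1_2$; (CNT.3) $C_{2\to1}C_{2\to3}=C_{2\to3}C_{2\to1}$; (CNT.4) $(|1\rangle\otimes1_1)C_{1\to2}=(|1\rangle\otimes1_1)C_{1\to2}(\langle1|\otimes1_1)(|1\rangle\otimes1_1)$ and $C_{1\to2}(\langle1|\otimes1_1)=(\langle1|\otimes1_1)(|1\rangle\otimes1_1)C_{1\to2}(\langle1|\otimes1_1)$; (CNT.5) $C_{1\to2}C_{3\to2}=C_{3\to2}C_{1\to2}$; (CNT.6) $|1\rangle\langle1|=1_0$; (CNT.7) $(|1\rangle\otimes|1\rangle\otimes1_1)C_{1\to2}C_{2\to3}(\langle1|\otimes1_2)=(|1\rangle\otimes|1\rangle\otimes1_1)C_{1\to2}(\langle1|\otimes1_2)$ and $(|1\rangle\otimes1_2)C_{2\to3}C_{1\to2}(\langle1|\otimes\langle1|\otimes1_1)=(|1\rangle\otimes1_2)C_{1\to2}(\langle1|\otimes\langle1|\otimes1_1)$;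 (CNT.8) $C_{1\to2}C_{2\to3}C_{1\to2}=C_{2\to3}C_{1\to3}$; (CNT.9) $(|1\rangle\otimes|1\rangle\otimes1_1)C_{1\to2}(\langle1|\otimes\langle1|\otimes1_1)=(|1\rangle\otimes|1\rangle\otimes\langle1|)C_{1\to2}(\langle1|\otimes\langle1|\otimes|1\rangle)$. A restriction category is a category with an assignment $f\mapsto\overline f:A\to A$ for each $f:A\to B$ such that $\overline f f=f$, $\overline f\,\overline g=\overline g\,\overline f$ and $\overline{\overline g f}=\overline f\,\overline g$ when $\mathrm{dom} f=\mathrm{dom} g$, and $f\overline g=\overline{fg}f$ when $\mathrm{cod}f=\mathrm{dom}g$. A map is total if $\overline f=1$. An inverse category is a restriction category in which every map $f$ is a partial isomorphism (there is $g$ with $fg=\overline f$, $gf=\overline g$); equivalently, a category with an identity-on-objects involution $(-)^\circ:\mathbb{X}^{op}\to\mathbb{X}$ with $(c^\circ)^\circ=c$, $cc^\circ c=c$, $cc^\circ dd^\circ=dd^\circ cc^\circ$, with $\overline c=cc^\circ$. An inverse category with a (symmetric) tensor product $\otimes$ preserving $(-)^\circ$ has inverse products if there is a total natural transformation $\Delta_A:A\to A\otimes A$ which is cocommutative ($\Delta_A c_{A,A}=\Delta_A$), coassociative ($\Delta_A(1\otimes\Delta_A)=\Delta_A(\Delta_A\otimes1)a_{A,A,A}$), such that $(\Delta_A,\Delta_A^\circ)$ is semi-Frobenius ($(\Delta_A\otimes1)a_{A,A,A}(1\otimes\Delta_A^\circ)=\Delta_A^\circ\Delta_A=(1\otimes\Delta_A)a^\circ_{A,A,A}(\Delta_A^\circ\otimes1)$),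 and uniform copying holds ($\Delta_{A\otimes B}=(\Delta_A\otimes\Delta_B)\mathsf{ex}_{A,B}$, where $\mathsf{ex}:(A\otimes A)\otimes(B\otimes B)\to(A\otimes B)\otimes(A\otimes B)$ is the canonical exchange isomorphism built from associators and symmetry). A discrete inverse category is an inverse category with inverse products. *)

(* Defs.v *)
From Stdlib Require Import Setoid Morphisms Arith Eqdep_dec.

Set Implicit Arguments.
Unset Strict Implicit.
Unset Printing Implicit Defensive.

Declare Scope cat_scope.
Open Scope cat_scope.

Reserved Notation "f ≈ g" (at level 70, no associativity).
Reserved Notation "f ;; g" (at level 40, left associativity).
Reserved Notation "A [x] B" (at level 39, left associativity).
Reserved Notation "f [*] g" (at level 39, left associativity).

(** * Categories

  Equality of parallel maps is an equivalence relation [heq], so that a category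
  presented by generators and relations needs no explicit quotient; every
  operation on maps is required to respect it.  Composition is diagrammatic:
  [f ;; g] is first [f], then [g]. *)

Record Category := {
  Ob :> Type;
  Hom : Ob -> Ob -> Type;
  heq : forall A B, Hom A B -> Hom A B -> Prop;
  idm : forall A, Hom A A;
  comp : forall A B D, Hom A B -> Hom B D -> Hom A D;
  heq_equiv : forall A B, Equivalence (@heq A B);
  comp_proper : forall A B D,
    Proper (@heq A B ==> @heq B D ==> @heq A D) (@comp A B D);
  comp_idl : forall A B (f : Hom A B), heq (comp (idm A) f) f;
  comp_idr : forall A B (f : Hom A B), heq (comp f (idm B)) f;
  comp_assoc : forall A B D E (f : Hom A B) (g : Hom B D) (h : Hom D E),
    heq (comp (comp f g) h) (comp f (comp g h))
}.

Arguments Hom {c} _ _.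
Arguments heq {c A B} _ _.
Arguments idm {c} A.
Arguments comp {c A B D} _ _.

Notation "f ≈ g" := (heq f g) : cat_scope.
Notation "f ;; g" := (comp f g) : cat_scope.

#[export] Existing Instance heq_equiv.
#[export] Existing Instance comp_proper.

(** * Symmetric monoidal categories *)

Record SymMonCat := {
  smc_cat :> Category;
  unit_ob : smc_cat;
  tens : smc_cat -> smc_cat -> smc_cat;
  tensm : forall A B A' B' : smc_cat,
    Hom A A' -> Hom B B' -> Hom (tens A B) (tens A' B');
  assoc : forall A B D, Hom (tens (tens A B) D) (tens A (tens B D));
  associ : forall A B D, Hom (tens A (tens B D)) (tens (tens A B) D);
  lunit : forall A, Hom (tens unit_ob A) A;
  luniti : forall A, Hom A (tens unit_ob A);
  runit : forall A, Hom (tens A unit_ob) A;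
  runiti : forall A, Hom A (tens A unit_ob);
  sym : forall A B, Hom (tens A B) (tens B A);

  tensm_proper : forall A B A' B',
    Proper (@heq _ A A' ==> @heq _ B B' ==> @heq _ (tens A B) (tens A' B'))
      (@tensm A B A' B');
  tensm_id : forall A B, tensm (idm A) (idm B) ≈ idm (tens A B);
  tensm_comp : forall A B A' B' A'' B''
      (f : Hom A A') (f' : Hom A' A'') (g : Hom B B') (g' : Hom B' B''),
    tensm (f ;; f') (g ;; g') ≈ tensm f g ;; tensm f' g';

  assoc_nat : forall A B D A' B' D' (f : Hom A A') (g : Hom B B') (h : Hom D D'),
    tensm (tensm f g) h ;; assoc A' B' D' ≈ assoc A B D ;; tensm f (tensm g h);
  lunit_nat : forall A B (f : Hom A B),
    tensm (idm unit_ob) f ;; lunit B ≈ lunit A ;; f;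
  runit_nat : forall A B (f : Hom A B),
    tensm f (idm unit_ob) ;; runit B ≈ runit A ;; f;
  sym_nat : forall A B A' B' (f : Hom A A') (g : Hom B B'),
    tensm f g ;; sym A' B' ≈ sym A B ;; tensm g f;

  assocK : forall A B D, assoc A B D ;; associ A B D ≈ idm _;
  associK : forall A B D, associ A B D ;; assoc A B D ≈ idm _;
  lunitK : forall A, lunit A ;; luniti A ≈ idm _;
  lunitiK : forall A, luniti A ;; lunit A ≈ idm _;
  runitK : forall A, runit A ;; runiti A ≈ idm _;
  runitiK : forall A, runiti A ;; runit A ≈ idm _;
  symK : forall A B, sym A B ;; sym B A ≈ idm _;

  pentagon : forall A B D E,
    assoc (tens A B) D E ;; assoc A B (tens D E)
    ≈ tensm (assoc A B D) (idm E) ;; assoc A (tens B D) E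
         ;; tensm (idm A) (assoc B D E);
  triangle : forall A B,
    assoc A unit_ob B ;; tensm (idm A) (lunit B) ≈ tensm (runit A) (idm B);
  hexagon : forall A B D,
    assoc A B D ;; sym A (tens B D) ;; assoc B D A
    ≈ tensm (sym A B) (idm D) ;; assoc B A D ;; tensm (idm B) (sym A D)
}.

Arguments unit_ob {s}.
Arguments tens {s} _ _.
Arguments tensm {s A B A' B'} _ _.
Arguments assoc {s} A B D.
Arguments associ {s} A B D.
Arguments lunit {s} A.
Arguments luniti {s} A.
Arguments runit {s} A.
Arguments runiti {s} A.
Arguments sym {s} A B.

Notation "A [x] B" := (tens A B) : cat_scope.
Notation "f [*] g" := (tensm f g) : cat_scope.

#[export] Existing Instance tensm_proper.

(** [(A A)(B B) -> A(A(B B)) -> A((A B)B) -> A((B A)B) -> A(B(A B)) -> (A B)(A B)] *)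
Definition exch (M : SymMonCat) (A B : M) :
    Hom ((A [x] A) [x] (B [x] B)) ((A [x] B) [x] (A [x] B)) :=
  assoc A A (B [x] B)
  ;; (idm A [*] associ A B B)
  ;; (idm A [*] (sym A B [*] idm B))
  ;; (idm A [*] assoc B A B)
  ;; associ A B (A [x] B).

(** * Restriction categories and inverse categories *)

Record RestrictionStructure (C : Category) := {
  restr : forall A B : C, Hom A B -> Hom A A;
  restr_proper : forall A B, Proper (heq ==> heq) (@restr A B);
  restr_self : forall A B (f : Hom A B), restr f ;; f ≈ f;
  restr_comm : forall A B D (f : Hom A B) (g : Hom A D),
    restr f ;; restr g ≈ restr g ;; restr f;
  restr_restr : forall A B D (f : Hom A B) (g : Hom A D),
    restr (restr g ;; f) ≈ restr f ;; restr g;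
  restr_comp : forall A B D (f : Hom A B) (g : Hom B D),
    f ;; restr g ≈ restr (f ;; g) ;; f
}.

#[export] Existing Instance restr_proper.

Definition total (C : Category) (R : RestrictionStructure C) (A B : C)
    (f : Hom A B) : Prop :=
  restr R f ≈ idm A.

Definition is_partial_inverse (C : Category) (R : RestrictionStructure C)
    (A B : C) (f : Hom A B) (g : Hom B A) : Prop :=
  f ;; g ≈ restr R f /\ g ;; f ≈ restr R g.

Lemma partial_inverse_unique (C : Category) (R : RestrictionStructure C)
    (A B : C) (f : Hom A B) (g g' : Hom B A) :
  is_partial_inverse R f g -> is_partial_inverse R f g' -> g ≈ g'.
Proof.
  intros [fg gf] [fg' gf'].
  transitivity (restr R g' ;; g).
  - assert (E : restr R g ;; restr R g' ;; g ≈ g).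
    { rewrite <- gf, <- gf'.
      rewrite (comp_assoc g f), <- (comp_assoc f g' f), fg', restr_self, gf.
      apply restr_self. }
    rewrite <- E at 1.
    rewrite restr_comm, comp_assoc, restr_self. reflexivity.
  - rewrite <- gf', comp_assoc, fg, <- fg', <- comp_assoc, gf'.
    apply restr_self.
Qed.

(** A restriction category in which every map is a partial isomorphism.  The
  partial inverse [f°] is recorded as a function; by [partial_inverse_unique]
  it is determined by the restriction structure. *)
Record InverseStructure (C : Category) := {
  inv_restr :> RestrictionStructure C;
  pinv : forall A B : C, Hom A B -> Hom B A;
  pinv_proper : forall A B, Proper (heq ==> heq) (@pinv A B);
  pinvP : forall A B (f : Hom A B), is_partial_inverse inv_restr f (pinv f)
}.

#[export] Existing Instance pinv_proper.

Definition tensor_preserves_pinv (M : SymMonCat) (I : InverseStructure M) : Prop :=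
  forall (A B A' B' : M) (f : Hom A A') (g : Hom B B'),
    pinv I (f [*] g) ≈ pinv I f [*] pinv I g.

(** * Inverse products *)

Record is_inverse_product (M : SymMonCat) (I : InverseStructure M)
    (Delta : forall A : M, Hom A (A [x] A)) : Prop := {
  Delta_total : forall A, total I (Delta A);
  Delta_nat : forall A B (f : Hom A B), f ;; Delta B ≈ Delta A ;; (f [*] f);
  Delta_cocomm : forall A, Delta A ;; sym A A ≈ Delta A;
  Delta_coassoc : forall A,
    Delta A ;; (idm A [*] Delta A) ≈ Delta A ;; (Delta A [*] idm A) ;; assoc A A A;
  Delta_frob_l : forall A,
    (Delta A [*] idm A) ;; assoc A A A ;; (idm A [*] pinv I (Delta A))
    ≈ pinv I (Delta A) ;; Delta A;
  Delta_frob_r : forall A,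
    pinv I (Delta A) ;; Delta A
    ≈ (idm A [*] Delta A) ;; pinv I (assoc A A A) ;; (pinv I (Delta A) [*] idm A);
  Delta_uniform : forall A B, Delta (A [x] B) ≈ (Delta A [*] Delta B) ;; exch A B
}.

Definition has_inverse_products (M : SymMonCat) (I : InverseStructure M) : Prop :=
  exists Delta : forall A : M, Hom A (A [x] A), is_inverse_product I Delta.

Definition is_discrete_inverse_category (M : SymMonCat) : Prop :=
  exists I : InverseStructure M, tensor_preserves_pinv I /\ has_inverse_products I.

(** * The category CNOT

  [circ n m] is the type of formal circuits from [n] wires to [m] wires.  The
  symmetries [c_swap n m : n + m -> m + n] belong to the free symmetric monoidal
  structure; the generating [sigma] is [c_swap 1 1]. *)

Inductive circ : nat -> nat -> Set :=
| c_id n : circ n n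
| c_comp n m p : circ n m -> circ m p -> circ n p
| c_tens n m n' m' : circ n n' -> circ m m' -> circ (n + m) (n' + m')
| c_swap n m : circ (n + m) (m + n)
| cnot : circ 2 2
| ket1 : circ 0 1
| bra1 : circ 1 0.

Declare Scope circ_scope.
Delimit Scope circ_scope with circ.
Bind Scope circ_scope with circ.
Notation "f ;; g" := (c_comp f g) : circ_scope.
Notation "f [*] g" := (c_tens f g) : circ_scope.

(** The identity map along a provable equality of objects.  The monoidal
  structure is strict, but [(n + m) + p] and [n + (m + p)] are not convertible;
  [c_idto] of such an equation is what the identity becomes. *)
Definition c_idto (n m : nat) (e : n = m) : circ n m :=
  match e with eq_refl => c_id n end.

Definition c_assoc (n m p : nat) : circ (n + m + p) (n + (m + p)) :=
  c_idto (eq_sym (Nat.add_assoc n m p)).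
Definition c_runit (n : nat) : circ (n + 0) n := c_idto (Nat.add_0_r n).

Definition sigma : circ 2 2 := c_swap 1 1.

(** [Ck_ij] is the cnot gate on [k] wires, with control [i] and target [j]. *)
Definition C2_12 : circ 2 2 := cnot.
Definition C2_21 : circ 2 2 := (sigma ;; cnot ;; sigma)%circ.
Definition C3_12 : circ 3 3 := (C2_12 [*] c_id 1)%circ.
Definition C3_21 : circ 3 3 := (C2_21 [*] c_id 1)%circ.
Definition C3_23 : circ 3 3 := (c_id 1 [*] C2_12)%circ.
Definition C3_32 : circ 3 3 := (c_id 1 [*] C2_21)%circ.
Definition C3_13 : circ 3 3 :=
  ((sigma [*] c_id 1) ;; C3_23 ;; (sigma [*] c_id 1))%circ.

Inductive cnot_rel : forall n m : nat, circ n m -> circ n m -> Prop :=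
| CNT1 : cnot_rel (C2_12 ;; C2_21 ;; C2_12) sigma
| CNT2 : cnot_rel (C2_12 ;; C2_12) (c_id 2)
| CNT3 : cnot_rel (C3_21 ;; C3_23) (C3_23 ;; C3_21)
| CNT4a : cnot_rel
    ((ket1 [*] c_id 1) ;; C2_12)
    ((ket1 [*] c_id 1) ;; C2_12 ;; (bra1 [*] c_id 1) ;; (ket1 [*] c_id 1))
| CNT4b : cnot_rel
    (C2_12 ;; (bra1 [*] c_id 1))
    ((bra1 [*] c_id 1) ;; (ket1 [*] c_id 1) ;; C2_12 ;; (bra1 [*] c_id 1))
| CNT5 : cnot_rel (C3_12 ;; C3_32) (C3_32 ;; C3_12)
| CNT6 : cnot_rel (ket1 ;; bra1) (c_id 0)
| CNT7a : cnot_rel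
    ((ket1 [*] ket1 [*] c_id 1) ;; C3_12 ;; C3_23 ;; (bra1 [*] c_id 2))
    ((ket1 [*] ket1 [*] c_id 1) ;; C3_12 ;; (bra1 [*] c_id 2))
| CNT7b : cnot_rel
    ((ket1 [*] c_id 2) ;; C3_23 ;; C3_12 ;; (bra1 [*] bra1 [*] c_id 1))
    ((ket1 [*] c_id 2) ;; C3_12 ;; (bra1 [*] bra1 [*] c_id 1))
| CNT8 : cnot_rel (C3_12 ;; C3_23 ;; C3_12) (C3_23 ;; C3_13)
| CNT9 : cnot_rel
    ((ket1 [*] ket1 [*] c_id 1) ;; C3_12 ;; (bra1 [*] bra1 [*] c_id 1))
    ((ket1 [*] ket1 [*] bra1) ;; C2_12 ;; (bra1 [*] bra1 [*] ket1)).

(** The congruence generated by the laws of a strict symmetric monoidal category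
  and [cnot_rel].  Strictness is [ceq_assoc], [ceq_lunit] and [ceq_runit]: the
  associators and unitors are identities. *)
Inductive ceq : forall n m : nat, circ n m -> circ n m -> Prop :=
| ceq_refl n m (f : circ n m) : ceq f f
| ceq_sym n m (f g : circ n m) : ceq f g -> ceq g f
| ceq_trans n m (f g h : circ n m) : ceq f g -> ceq g h -> ceq f h
| ceq_comp n m p (f f' : circ n m) (g g' : circ m p) :
    ceq f f' -> ceq g g' -> ceq (f ;; g) (f' ;; g')
| ceq_tens n m n' m' (f f' : circ n n') (g g' : circ m m') :
    ceq f f' -> ceq g g' -> ceq (f [*] g) (f' [*] g')
| ceq_comp_idl n m (f : circ n m) : ceq (c_id n ;; f) f
| ceq_comp_idr n m (f : circ n m) : ceq (f ;; c_id m) f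
| ceq_comp_assoc n m p q (f : circ n m) (g : circ m p) (h : circ p q) :
    ceq (f ;; g ;; h) (f ;; (g ;; h))
| ceq_tens_id n m : ceq (c_id n [*] c_id m) (c_id (n + m))
| ceq_tens_comp n m n' m' n'' m''
    (f : circ n n') (f' : circ n' n'') (g : circ m m') (g' : circ m' m'') :
    ceq ((f ;; f') [*] (g ;; g')) ((f [*] g) ;; (f' [*] g'))
| ceq_assoc n m p n' m' p' (f : circ n n') (g : circ m m') (h : circ p p') :
    ceq ((f [*] g [*] h) ;; c_assoc n' m' p') (c_assoc n m p ;; (f [*] (g [*] h)))
| ceq_lunit n m (f : circ n m) : ceq (c_id 0 [*] f) f
| ceq_runit n m (f : circ n m) : ceq ((f [*] c_id 0) ;; c_runit m) (c_runit n ;; f)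
| ceq_swap_nat n m n' m' (f : circ n n') (g : circ m m') :
    ceq ((f [*] g) ;; c_swap n' m') (c_swap n m ;; (g [*] f))
| ceq_swapK n m : ceq (c_swap n m ;; c_swap m n) (c_id (n + m))
| ceq_hexagon n m p :
    ceq (c_assoc n m p ;; c_swap n (m + p) ;; c_assoc m p n)
        ((c_swap n m [*] c_id p) ;; c_assoc m n p ;; (c_id m [*] c_swap n p))
| ceq_rel n m (f g : circ n m) : cnot_rel f g -> ceq f g.

#[export] Instance ceq_equiv n m : Equivalence (@ceq n m).
Proof.
  split; [exact (@ceq_refl n m) | exact (@ceq_sym n m) | exact (@ceq_trans n m)].
Qed.

#[export] Instance c_comp_proper n m p :
  Proper (@ceq n m ==> @ceq m p ==> @ceq n p) (@c_comp n m p).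
Proof. intros f f' Hf g g' Hg; exact (ceq_comp Hf Hg). Qed.

#[export] Instance c_tens_proper n m n' m' :
  Proper (@ceq n n' ==> @ceq m m' ==> @ceq (n + m) (n' + m')) (@c_tens n m n' m').
Proof. intros f f' Hf g g' Hg; exact (ceq_tens Hf Hg). Qed.

Lemma c_idto_irrel n m (e e' : n = m) : ceq (c_idto e) (c_idto e').
Proof. rewrite (UIP_dec Nat.eq_dec e e'). reflexivity. Qed.

Lemma c_idto_id n (e : n = n) : ceq (c_idto e) (c_id n).
Proof. exact (c_idto_irrel e eq_refl). Qed.

Lemma c_idto_comp n m p (e : n = m) (e' : m = p) :
  ceq (c_idto e ;; c_idto e') (c_idto (eq_trans e e')).
Proof. destruct e'; destruct e; apply ceq_comp_idl. Qed.

Lemma c_idto_tens n m n' m' (e : n = n') (e' : m = m') (e'' : n + m = n' + m') :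
  ceq (c_idto e [*] c_idto e') (c_idto e'').
Proof.
  destruct e; destruct e'.
  transitivity (c_id (n + m)); [exact (ceq_tens_id n m) |].
  symmetry; apply c_idto_id.
Qed.

Lemma c_assoc_pentagon n m p q :
  ceq (c_assoc (n + m) p q ;; c_assoc n m (p + q))
      ((c_assoc n m p [*] c_id q) ;; c_assoc n (m + p) q
         ;; (c_id n [*] c_assoc m p q)).
Proof.
  change (c_id q) with (c_idto (eq_refl q)).
  change (c_id n) with (c_idto (eq_refl n)).
  unfold c_assoc.
  rewrite (c_idto_tens _ _ (f_equal (fun k => k + q) (eq_sym (Nat.add_assoc n m p)))).
  rewrite (c_idto_tens _ _ (f_equal (Nat.add n) (eq_sym (Nat.add_assoc m p q)))).
  rewrite !c_idto_comp. apply c_idto_irrel.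
Qed.

Lemma c_assoc_triangle n m :
  ceq (c_assoc n 0 m ;; (c_id n [*] c_id m)) (c_runit n [*] c_id m).
Proof.
  transitivity (c_assoc n 0 m).
  - transitivity (c_assoc n 0 m ;; c_id (n + m))%circ.
    + exact (ceq_comp (ceq_refl (c_assoc n 0 m)) (ceq_tens_id n m)).
    + apply ceq_comp_idr.
  - symmetry. exact (c_idto_tens (Nat.add_0_r n) (eq_refl m) _).
Qed.

Lemma c_idto_compK n m (e : n = m) (e' : m = n) :
  ceq (c_idto e ;; c_idto e') (c_id n).
Proof. rewrite c_idto_comp. apply c_idto_id. Qed.

Lemma c_lunit_nat n m (f : circ n m) : ceq ((c_id 0 [*] f) ;; c_id m) (c_id n ;; f).
Proof. rewrite ceq_comp_idl, (ceq_comp_idr (c_id 0 [*] f)). apply ceq_lunit. Qed.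

Definition CNOT_cat : Category := {|
  Ob := nat;
  Hom := circ;
  heq := ceq;
  idm := c_id;
  comp := c_comp;
  heq_equiv := ceq_equiv;
  comp_proper := c_comp_proper;
  comp_idl := ceq_comp_idl;
  comp_idr := ceq_comp_idr;
  comp_assoc := ceq_comp_assoc
|}.

Definition CNOT : SymMonCat := {|
  smc_cat := CNOT_cat;
  unit_ob := 0 : CNOT_cat;
  tens := Nat.add : CNOT_cat -> CNOT_cat -> CNOT_cat;
  tensm := c_tens;
  assoc := c_assoc;
  associ := fun n m p => c_idto (Nat.add_assoc n m p);
  lunit := c_id;
  luniti := c_id;
  runit := c_runit;
  runiti := fun n => c_idto (eq_sym (Nat.add_0_r n));
  sym := c_swap;
  tensm_proper := c_tens_proper;
  tensm_id := ceq_tens_id;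
  tensm_comp := ceq_tens_comp;
  assoc_nat := ceq_assoc;
  lunit_nat := c_lunit_nat;
  runit_nat := ceq_runit;
  sym_nat := ceq_swap_nat;
  assocK := fun n m p => c_idto_compK _ _;
  associK := fun n m p => c_idto_compK _ _;
  lunitK := fun n => ceq_comp_idl (c_id n);
  lunitiK := fun n => ceq_comp_idl (c_id n);
  runitK := fun n => c_idto_compK _ _;
  runitiK := fun n => c_idto_compK _ _;
  symK := ceq_swapK;
  pentagon := c_assoc_pentagon;
  triangle := c_assoc_triangle;
  hexagon := ceq_hexagon
|}.

(* Main.v *)
(** Write [f°] for the mirror image of a circuit [f], and let [Δ] copy a wire by a
  cnot onto a fresh |0>.  The relations of CNOT make [Δ] cocommutative,
  coassociative, semi-Frobenius and natural for every generator.  Moreover every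
  circuit satisfies the graph equation [Δ (f ⊗ 1) = f Δ (1 ⊗ f°)]: it holds for the
  generators, and it is stable under composition and tensor.  Together with
  naturality and [Δ Δ° = 1], the graph equations of [f] and [f°] give [f f° f = f],
  and those of [e = f f°] give [Δ (e ⊗ 1) = e Δ], hence such idempotents commute.
  The bookkeeping of wires is discharged by coherence: two circuits made of
  symmetries and identities are equal as soon as they move every wire to the same
  position. *)

From Stdlib Require Import Setoid Morphisms Arith Lia List.
Import ListNotations.
Require Import Defs.

Set Implicit Arguments.
Unset Strict Implicit.
Unset Printing Implicit Defensive.

Local Open Scope circ_scope.
Local Notation "f ≅ g" := (ceq f g) (at level 70, no associativity).

(** * Coherence for wire permutations *)

(** The graph equation is there because the inverse laws do not support an induction on circuits by
    themselves: to get [f g (f g)° f g = f g] from the same law for [f] and [g], the idempotents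
    [f° f] and [g g°] must commute, and that commutation has no inductive proof of its own. The
    graph equation is stronger and closed under composition without any such help: both its sides
    describe the pairs [(f x, x)], read from either end of [f]. The second obstacle is strictness.
    Sums of arities are associative only up to a propositional equality, so associators are casts,
    and every regrouping of wires has to be proved. Hence the normal form for permutation circuits
    below: each such circuit becomes a word in adjacent transpositions, and the word is sorted using
    involution, the braid law and commutation of distant swaps. Afterwards an equation between
    rewirings is a statement about natural numbers, settled by [lia]. *)

Ltac tens_congr :=
  lazymatch goal with
  | |- @ceq _ _ (@c_tens ?a ?b ?c ?d ?f ?g) (@c_tens _ _ _ _ ?f' ?g') =>
    refine (@ceq_tens a b c d f f' g g' _ _)
  end.

Lemma tens_assoc_cast n m p n' m' p' (f : circ n n') (g : circ m m') (h : circ p p')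
    (e : n + m + p = n + (m + p)) (e' : n' + m' + p' = n' + (m' + p')) :
  (f [*] g [*] h) ;; c_idto e' ≅ c_idto e ;; (f [*] (g [*] h)).
Proof.
  rewrite (c_idto_irrel e (eq_sym (Nat.add_assoc n m p))).
  rewrite (c_idto_irrel e' (eq_sym (Nat.add_assoc n' m' p'))).
  apply ceq_assoc.
Qed.

(** With a single wire in front, both bracketings of the arities compute to the same number, so the
    associator disappears. *)
Lemma tens_assoc1 m m' p p' (f : circ 1 1) (g : circ m m') (h : circ p p') :
  @ceq (S (m + p)) (S (m' + p')) (f [*] g [*] h) (f [*] (g [*] h)).
Proof.
  pose proof (@tens_assoc_cast 1 m p 1 m' p' f g h eq_refl eq_refl) as H.
  simpl in H. rewrite ceq_comp_idl in H. rewrite <- H.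
  symmetry; apply ceq_comp_idr.
Qed.

Definition up n m (f : circ n m) : circ (S n) (S m) := c_id 1 [*] f.

#[local] Instance up_proper n m : Proper (@ceq n m ==> @ceq (S n) (S m)) (@up n m).
Proof. intros f g H. unfold up. tens_congr; [reflexivity | exact H]. Qed.

Lemma up_id n : up (c_id n) ≅ c_id (S n).
Proof. apply (ceq_tens_id 1 n). Qed.

Lemma up_comp n m p (f : circ n m) (g : circ m p) : up (f ;; g) ≅ up f ;; up g.
Proof.
  unfold up.
  transitivity ((c_id 1 ;; c_id 1) [*] (f ;; g)).
  - tens_congr; [symmetry; apply ceq_comp_idl | reflexivity].
  - apply (ceq_tens_comp (c_id 1) (c_id 1) f g).
Qed.

Definition sw k : circ (S (S k)) (S (S k)) := sigma [*] c_id k.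

Lemma sw_sw k : sw k ;; sw k ≅ c_id (S (S k)).
Proof.
  unfold sw. etransitivity; [symmetry; apply (ceq_tens_comp sigma sigma (c_id k) (c_id k))|].
  etransitivity; [|apply (ceq_tens_id 2 k)].
  tens_congr; [apply (ceq_swapK 1 1) | apply ceq_comp_idl].
Qed.

Lemma up_up n m (f : circ n m) : up (up f) ≅ c_id 2 [*] f.
Proof.
  unfold up. etransitivity; [symmetry; apply (tens_assoc1 (c_id 1) (c_id 1) f)|].
  tens_congr; [apply (ceq_tens_id 1 1) | reflexivity].
Qed.

Lemma tens_interchange n n' m m' (f : circ n n') (g : circ m m') :
  (f [*] c_id m) ;; (c_id n' [*] g) ≅ (c_id n [*] g) ;; (f [*] c_id m').
Proof.
  rewrite <- !ceq_tens_comp, !ceq_comp_idl, !ceq_comp_idr. reflexivity.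
Qed.

Lemma sw_up_up n m (f : circ n m) : sw n ;; up (up f) ≅ up (up f) ;; sw m.
Proof. rewrite up_up. apply (tens_interchange sigma f). Qed.

Lemma swap_one_succ p : c_swap 1 (S p) ≅ sw p ;; up (c_swap 1 p).
Proof.
  pose proof (ceq_hexagon 1 1 p) as H.
  assert (E1 : forall q, c_assoc 1 p q ≅ c_id (S (p + q))) by (intro; apply c_idto_id).
  assert (E2 : c_assoc 1 1 p ≅ c_id (S (S p))) by apply c_idto_id.
  rewrite (ceq_comp (ceq_comp E2 (ceq_refl (c_swap 1 (1 + p)))) (E1 1)) in H.
  rewrite (ceq_comp (ceq_comp (ceq_refl (c_swap 1 1 [*] c_id p)) E2)
              (ceq_refl (c_id 1 [*] c_swap 1 p))) in H.
  etransitivity; [|etransitivity; [exact H|]].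
  - symmetry. etransitivity; [apply ceq_comp_idr | apply ceq_comp_idl].
  - apply ceq_comp; [apply ceq_comp_idr | reflexivity].
Qed.

(** On three wires this is naturality of [c_swap 1 2], itself two adjacent swaps by the hexagon,
    with respect to [sigma]. The remaining [k] wires are tensored on afterwards. *)
Lemma braid k :
  sw (S k) ;; up (sw k) ;; sw (S k) ≅ up (sw k) ;; sw (S k) ;; up (sw k).
Proof.
  assert (H : sw 1 ;; up sigma ;; sw 1 ≅ up sigma ;; sw 1 ;; up sigma).
  { assert (E : c_swap 1 2 ≅ sw 1 ;; up sigma).
    { apply (swap_one_succ 1). }
    rewrite <- E.
    etransitivity; [symmetry; apply (ceq_swap_nat (c_id 1) sigma)|].
    rewrite ceq_comp_assoc. apply ceq_comp; [reflexivity | exact E]. }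
  assert (E1 : sw (S k) ≅ sw 1 [*] c_id k).
  { unfold sw. symmetry.
    pose proof (@tens_assoc_cast 2 1 k 2 1 k sigma (c_id 1) (c_id k) eq_refl eq_refl) as A.
    simpl in A. rewrite ceq_comp_idl in A.
    etransitivity; [symmetry; apply ceq_comp_idr|]. etransitivity; [exact A|].
    tens_congr; [reflexivity | apply (ceq_tens_id 1 k)]. }
  assert (E2 : up (sw k) ≅ up sigma [*] c_id k).
  { symmetry. apply (tens_assoc1 (c_id 1) sigma (c_id k)). }
  rewrite (ceq_comp (ceq_comp E1 E2) E1), (ceq_comp (ceq_comp E2 E1) E2).
  assert (F : forall a b c : circ 3 3,
     (a [*] c_id k) ;; (b [*] c_id k) ;; (c [*] c_id k) ≅ (a ;; b ;; c) [*] c_id k).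
  { intros a b c. rewrite <- !ceq_tens_comp, !ceq_comp_idl. reflexivity. }
  etransitivity; [apply F|]. etransitivity; [|symmetry; apply F].
  tens_congr; [exact H | reflexivity].
Qed.

(** The adjacent swap of wires [i] and [i + 1]; out of range it amounts to an identity. *)
Fixpoint transp (n i : nat) : circ n n :=
  match n with
  | 0 => c_id 0
  | S n' =>
    match i with
    | 0 => match n' return circ (S n') (S n') with 0 => c_id 1 | S k => sw k end
    | S i' => up (transp n' i')
    end
  end.

(** The cycle that carries wire 0 to position [j] while wires 1 to [j] each move to the preceding
    position. *)
Fixpoint ins (k j : nat) : circ (S k) (S k) :=
  match k return circ (S k) (S k) with
  | 0 => c_id 1
  | S k' => match j with 0 => c_id _ | S j' => sw k' ;; up (ins k' j') end
  end.

Lemma ins0 k : ins k 0 = c_id (S k).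
Proof. destruct k; reflexivity. Qed.

Lemma transp_invol n i : transp n i ;; transp n i ≅ c_id n.
Proof.
  revert i; induction n as [|n IH]; intros i; simpl.
  - apply ceq_comp_idl.
  - destruct i as [|i].
    + destruct n; [apply ceq_comp_idl | apply sw_sw].
    + rewrite <- up_comp, IH. apply up_id.
Qed.

(** After the cycle, positions [i] and [i + 1] hold wires [i + 1] and [i + 2], whence the shift by
    [up] on the other side. The braid law enters only at [i = 0]; the other cases peel off an outer
    wire. *)
Lemma ins_transp_lt k j i : S i < j -> j <= k ->
  ins k j ;; transp (S k) i ≅ up (transp k i) ;; ins k j.
Proof.
  revert j i; induction k as [|k IH]; intros j i Hij Hj; [lia|].
  destruct j as [|j]; [lia|]. simpl ins.
  destruct i as [|i].
  - destruct j as [|j]; [lia|]. destruct k as [|k]; [lia|]. simpl.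
    rewrite up_comp, !ceq_comp_assoc, <- sw_up_up.
    rewrite <- !ceq_comp_assoc, braid. reflexivity.
  - change (transp (S (S k)) (S i)) with (up (transp (S k) i)).
    change (transp (S k) (S i)) with (up (transp k i)).
    rewrite ceq_comp_assoc, <- up_comp, IH by lia.
    rewrite up_comp, <- !ceq_comp_assoc, sw_up_up. reflexivity.
Qed.

(** A transposition that meets the end of the cycle shortens it by one step; the next lemma, by
    involutivity, is the lengthening. *)
Lemma ins_transp_pred k i : S i <= k -> ins k (S i) ;; transp (S k) i ≅ ins k i.
Proof.
  revert i; induction k as [|k IH]; intros i Hi; [lia|].
  simpl ins. destruct i as [|i].
  - rewrite ins0, up_id, ceq_comp_idr. apply sw_sw.
  - change (transp (S (S k)) (S i)) with (up (transp (S k) i)).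
    rewrite ceq_comp_assoc, <- up_comp, IH by lia. reflexivity.
Qed.

Lemma ins_transp_eq k i : S i <= k -> ins k i ;; transp (S k) i ≅ ins k (S i).
Proof.
  intro H. rewrite <- (ins_transp_pred H), ceq_comp_assoc, transp_invol.
  apply ceq_comp_idr.
Qed.

Lemma ins_transp_gt k j i : j <= i -> S i < k ->
  ins k j ;; transp (S k) (S i) ≅ up (transp k i) ;; ins k j.
Proof.
  revert j i; induction k as [|k IH]; intros j i Hij Hj; [lia|].
  change (transp (S (S k)) (S i)) with (up (transp (S k) i)).
  destruct j as [|j]; simpl ins.
  - rewrite ceq_comp_idl, ceq_comp_idr. reflexivity.
  - destruct i as [|i]; [lia|].
    change (transp (S k) (S i)) with (up (transp k i)) at 2.
    rewrite ceq_comp_assoc, <- up_comp, IH by lia.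
    rewrite up_comp, <- !ceq_comp_assoc, sw_up_up. reflexivity.
Qed.

(** * Normal forms of permutations by insertion *)

Definition tr i x := if x =? i then S i else if x =? S i then i else x.
(** Renumbers positions once position [j] has been removed; it is meant for [x] different from
    [j]. *)
Definition unbump j x := if x <? j then x else x - 1.

(** [canon n q] sends wire [i] to position [q i]: the other wires are arranged
  first, and then wire [0] is inserted at position [q 0]. *)
Fixpoint canon (n : nat) (q : nat -> nat) : circ n n :=
  match n with
  | 0 => c_id 0
  | S k => up (canon k (fun x => unbump (q 0) (q (S x)))) ;; ins k (q 0)
  end.

Definition perm_on n (q : nat -> nat) :=
  (forall i, i < n -> q i < n) /\
  (forall i j, i < n -> j < n -> q i = q j -> i = j).

Ltac cases_nat :=
  repeat match goal with
  | |- context [?a <? ?b] => destruct (Nat.ltb_spec a b); try lia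
  | |- context [?a =? ?b] => destruct (Nat.eqb_spec a b); try lia
  end.

Lemma canon_ext n q r : (forall i, i < n -> q i = r i) -> canon n q = canon n r.
Proof.
  revert q r; induction n as [|n IH]; intros q r H; simpl; [reflexivity|].
  rewrite (H 0) by lia.
  rewrite (IH _ (fun x => unbump (r 0) (r (S x)))); [reflexivity|].
  intros i Hi. rewrite (H (S i)) by lia. reflexivity.
Qed.

Lemma perm_on_tail n q : perm_on (S n) q ->
  perm_on n (fun x => unbump (q 0) (q (S x))).
Proof.
  intros [Hb Hi]. split.
  - intros i Hin. unfold unbump. pose proof (Hb (S i)). pose proof (Hb 0).
    assert (q (S i) <> q 0) by (intro E; apply Hi in E; lia).
    cases_nat.
  - intros i j Hin Hjn. unfold unbump.
    assert (q (S i) <> q 0) by (intro E; apply Hi in E; lia).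
    assert (q (S j) <> q 0) by (intro E; apply Hi in E; lia).
    intro E. enough (S i = S j) by lia.
    apply Hi; try lia. revert E. cases_nat.
Qed.

(** A transposition away from position [q 0] slides through the insertion and acts on the other
    wires by induction. One that touches [q 0] only lengthens or shortens the insertion, and the
    arrangement of the other wires stays as it was. *)
Lemma canon_transp n q i : perm_on n q -> S i < n ->
  canon n q ;; transp n i ≅ canon n (fun x => tr i (q x)).
Proof.
  revert q i; induction n as [|n IH]; intros q i Hq Hi; [lia|].
  pose proof (perm_on_tail Hq) as Hq'. destruct Hq as [Hb Hinj].
  assert (Hne : forall x, x < n -> q (S x) <> q 0)
    by (intros x Hx E; apply Hinj in E; lia).
  pose proof (Hb 0).
  simpl canon. rewrite ceq_comp_assoc.
  assert (Hcase : S i < q 0 \/ q 0 = S i \/ q 0 = i \/ q 0 < i) by lia.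
  destruct Hcase as [H'|[H'|[H'|H']]].
  - rewrite ins_transp_lt, <- ceq_comp_assoc, <- up_comp, IH by (auto; lia).
    replace (tr i (q 0)) with (q 0) by (unfold tr; cases_nat).
    rewrite (@canon_ext n (fun x => tr i (unbump (q 0) (q (S x))))
               (fun x => unbump (q 0) (tr i (q (S x))))); [reflexivity|].
    intros x Hx. specialize (Hne x Hx). unfold tr, unbump. cases_nat.
  - rewrite H', ins_transp_pred by lia.
    replace (tr i (S i)) with i by (unfold tr; cases_nat).
    rewrite (@canon_ext n (fun x => unbump (S i) (q (S x)))
               (fun x => unbump i (tr i (q (S x))))); [reflexivity|].
    intros x Hx. specialize (Hne x Hx). unfold tr, unbump. cases_nat.
  - rewrite H', ins_transp_eq by lia.
    replace (tr i i) with (S i) by (unfold tr; cases_nat).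
    rewrite (@canon_ext n (fun x => unbump i (q (S x)))
               (fun x => unbump (S i) (tr i (q (S x))))); [reflexivity|].
    intros x Hx. specialize (Hne x Hx). unfold tr, unbump. cases_nat.
  - destruct i as [|i]; [lia|].
    rewrite ins_transp_gt, <- ceq_comp_assoc, <- up_comp, IH by (auto; lia).
    replace (tr (S i) (q 0)) with (q 0) by (unfold tr; cases_nat).
    rewrite (@canon_ext n (fun x => tr i (unbump (q 0) (q (S x))))
               (fun x => unbump (q 0) (tr (S i) (q (S x))))); [reflexivity|].
    intros x Hx. specialize (Hne x Hx). unfold tr, unbump. cases_nat.
Qed.

Lemma canon_id n q : (forall i, i < n -> q i = i) -> canon n q ≅ c_id n.
Proof.
  revert q; induction n as [|n IH]; intros q H; simpl; [reflexivity|].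
  rewrite (H 0) by lia. rewrite ins0, ceq_comp_idr, IH; [apply up_id|].
  intros i Hi. rewrite H by lia. unfold unbump. cases_nat.
Qed.

Fixpoint word n (l : list nat) : circ n n :=
  match l with [] => c_id n | i :: l' => transp n i ;; word n l' end.

Fixpoint wsem (l : list nat) (x : nat) : nat :=
  match l with [] => x | i :: l' => wsem l' (tr i x) end.

Definition valid n l := Forall (fun i => S i < n) l.

Lemma perm_on_tr n i q : S i < n -> perm_on n q -> perm_on n (fun x => tr i (q x)).
Proof.
  intros Hi [Hb Hinj]. split.
  - intros x Hx. specialize (Hb x Hx). unfold tr. cases_nat.
  - intros x y Hx Hy E. apply Hinj; auto. revert E. unfold tr. cases_nat.
Qed.

Lemma canon_word n l q : valid n l -> perm_on n q ->
  canon n q ;; word n l ≅ canon n (fun x => wsem l (q x)).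
Proof.
  intro Hl; revert q; induction Hl as [|i l Hi Hl IH]; intros q Hq; simpl.
  - apply ceq_comp_idr.
  - rewrite <- ceq_comp_assoc, canon_transp by auto.
    apply (IH (fun x => tr i (q x))). apply perm_on_tr; auto.
Qed.

(** The identity is already in normal form, so the word can act on it letter by letter; words with
    the same action therefore agree. *)
Lemma word_canon n l : valid n l -> word n l ≅ canon n (wsem l).
Proof.
  intro H. rewrite <- (ceq_comp_idl (word n l)).
  rewrite <- (@canon_id n (fun x => x)) by reflexivity.
  rewrite canon_word; [reflexivity | auto |].
  split; auto.
Qed.

Lemma word_app n l l' : word n (l ++ l') ≅ word n l ;; word n l'.
Proof.
  induction l as [|i l IH]; simpl.
  - symmetry; apply ceq_comp_idl.
  - rewrite IH, ceq_comp_assoc. reflexivity.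
Qed.

Lemma wsem_app l l' x : wsem (l ++ l') x = wsem l' (wsem l x).
Proof. revert x; induction l as [|i l IH]; intro x; simpl; auto. Qed.

Lemma transp_tens n m i : S i < n -> transp n i [*] c_id m ≅ transp (n + m) i.
Proof.
  revert i; induction n as [|n IH]; intros i Hi; [lia|].
  destruct i as [|i].
  - destruct n as [|n]; [lia|]. simpl. unfold sw.
    pose proof (@tens_assoc_cast 2 n m 2 n m sigma (c_id n) (c_id m) eq_refl eq_refl) as A.
    simpl in A. rewrite ceq_comp_idl in A.
    etransitivity; [symmetry; apply ceq_comp_idr|]. etransitivity; [exact A|].
    tens_congr; [reflexivity | apply ceq_tens_id].
  - simpl. etransitivity; [apply (tens_assoc1 (c_id 1) (transp n i) (c_id m))|].
    unfold up. tens_congr; [reflexivity | apply IH; lia].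
Qed.

Lemma tens_transp n m i : c_id n [*] transp m i ≅ transp (n + m) (n + i).
Proof.
  induction n as [|n IH]; simpl.
  - apply ceq_lunit.
  - transitivity ((c_id 1 [*] c_id n) [*] transp m i).
    { tens_congr; [symmetry; apply (ceq_tens_id 1 n) | reflexivity]. }
    etransitivity; [apply (tens_assoc1 (c_id 1) (c_id n) (transp m i))|].
    unfold up. tens_congr; [reflexivity | exact IH].
Qed.

Lemma word_tens n m l : valid n l -> word n l [*] c_id m ≅ word (n + m) l.
Proof.
  induction 1 as [|i l Hi Hl IH]; simpl.
  - apply ceq_tens_id.
  - rewrite <- (transp_tens m Hi), <- IH, <- ceq_tens_comp, ceq_comp_idl. reflexivity.
Qed.

Lemma tens_word n m l : c_id n [*] word m l ≅ word (n + m) (map (Nat.add n) l).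
Proof.
  induction l as [|i l IH]; simpl.
  - apply ceq_tens_id.
  - rewrite <- tens_transp, <- IH, <- ceq_tens_comp, ceq_comp_idl. reflexivity.
Qed.

Lemma wsem_valid_ge n l x : valid n l -> n <= x -> wsem l x = x.
Proof.
  intro H; revert x; induction H as [|i l Hi Hl IH]; intros x Hx; simpl; auto.
  replace (tr i x) with x; [auto|]. unfold tr; cases_nat.
Qed.

Lemma wsem_valid_lt n l x : valid n l -> x < n -> wsem l x < n.
Proof.
  intro H; revert x; induction H as [|i l Hi Hl IH]; intros x Hx; simpl; auto.
  apply IH. unfold tr; cases_nat.
Qed.

Lemma wsem_shift n l x :
  wsem (map (Nat.add n) l) x = if x <? n then x else n + wsem l (x - n).
Proof.
  revert x; induction l as [|i l IH]; intros x; simpl; [cases_nat|].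
  rewrite IH. unfold tr.
  destruct (Nat.ltb_spec x n).
  - destruct (Nat.eqb_spec x (n + i)); [lia|].
    destruct (Nat.eqb_spec x (S (n + i))); [lia|]. cases_nat.
  - assert (E : (if x - n =? i then S i else if x - n =? S i then i else x - n)
       = (if x =? n + i then S (n + i) else if x =? S (n + i) then n + i else x) - n)
      by cases_nat.
    rewrite E. cases_nat.
Qed.

(** * Spelling permutation circuits as words *)

Fixpoint isperm n m (f : circ n m) : Prop :=
  match f with
  | c_id _ => True
  | c_comp f g => isperm f /\ isperm g
  | c_tens f g => isperm f /\ isperm g
  | c_swap _ _ => True
  | _ => False
  end.

(** [sem f i] is the output position of input wire [i]; it is meaningful only if
  [isperm f] and [i] is in range. *)
Fixpoint sem n m (f : circ n m) (i : nat) : nat :=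
  match f with
  | c_id _ => i
  | c_comp f g => sem g (sem f i)
  | @c_tens n _ n' _ f g => if i <? n then sem f i else n' + sem g (i - n)
  | c_swap n m => if i <? n then m + i else i - n
  | _ => i
  end.

Lemma isperm_idto n m (e : n = m) : isperm (c_idto e).
Proof. destruct e; exact I. Qed.

Lemma sem_idto n m (e : n = m) i : sem (c_idto e) i = i.
Proof. destruct e; reflexivity. Qed.

(** A word is an endomorphism, whereas [f] has two indices that are equal only provably; quantifying
    over the cast lets the claim be typed before that equality is eliminated. *)
Definition spelled n m (f : circ n m) (l : list nat) :=
  valid n l /\ (forall e : m = n, f ;; c_idto e ≅ word n l) /\
  (forall i, i < n -> sem f i = wsem l i).

Definition spellable n m (f : circ n m) := n = m /\ exists l, spelled f l.

Lemma spellable_ceq n m (f g : circ n m) : f ≅ g ->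
  (forall i, i < n -> sem f i = sem g i) -> spellable g -> spellable f.
Proof.
  intros H Hs [e [l [Hv [Hw Hl]]]]. split; [exact e|]. exists l. split; [exact Hv|].
  split.
  - intro e'. rewrite H. apply Hw.
  - intros i Hi. rewrite Hs; auto.
Qed.

Lemma spelled_endo n (f : circ n n) l : spelled f l -> f ≅ word n l.
Proof. intros [_ [H _]]. rewrite <- (H eq_refl). symmetry; apply ceq_comp_idr. Qed.

Lemma spellable_endo n (f : circ n n) l : valid n l -> f ≅ word n l ->
  (forall i, i < n -> sem f i = wsem l i) -> spellable f.
Proof.
  intros Hv H Hs. split; [reflexivity|]. exists l. split; [exact Hv|]. split; [|exact Hs].
  intro e. rewrite c_idto_id, ceq_comp_idr. exact H.
Qed.

Lemma spellable_idto n m (e : n = m) : spellable (c_idto e).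
Proof.
  destruct e. apply (@spellable_endo n _ []); [constructor | reflexivity | reflexivity].
Qed.

Lemma valid_app n l l' : valid n l -> valid n l' -> valid n (l ++ l').
Proof. intros. apply Forall_app; auto. Qed.

Lemma spellable_comp n m p (f : circ n m) (g : circ m p) :
  spellable f -> spellable g -> spellable (f ;; g).
Proof.
  intros [e [l Hl]] [e' [l' Hl']]. subst m. subst p.
  pose proof (spelled_endo Hl). pose proof (spelled_endo Hl').
  destruct Hl as [Hv [_ Hs]], Hl' as [Hv' [_ Hs']].
  apply (@spellable_endo _ _ (l ++ l')).
  - apply valid_app; auto.
  - rewrite word_app. apply ceq_comp; auto.
  - intros i Hi. simpl. rewrite wsem_app, Hs by auto. apply Hs'.
    apply wsem_valid_lt; auto.
Qed.

Lemma spellable_tens n m n' m' (f : circ n n') (g : circ m m') :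
  spellable f -> spellable g -> spellable (f [*] g).
Proof.
  intros [e [l Hl]] [e' [l' Hl']]. subst n'. subst m'.
  pose proof (spelled_endo Hl) as E. pose proof (spelled_endo Hl') as E'.
  destruct Hl as [Hv [_ Hs]], Hl' as [Hv' [_ Hs']].
  apply (@spellable_endo _ _ (l ++ map (Nat.add n) l')).
  - apply valid_app; unfold valid in *.
    + eapply Forall_impl; [|exact Hv]. simpl; intros; lia.
    + apply Forall_map. eapply Forall_impl; [|exact Hv']. simpl; intros; lia.
  - rewrite E, E', word_app, <- word_tens, <- tens_word by auto.
    rewrite <- ceq_tens_comp, ceq_comp_idl, ceq_comp_idr. reflexivity.
  - intros i Hi. simpl. rewrite wsem_app, wsem_shift.
    destruct (Nat.ltb_spec i n).
    + rewrite Hs by auto. pose proof (wsem_valid_lt Hv H). cases_nat.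
    + rewrite (wsem_valid_ge Hv) by auto. rewrite Hs' by lia. cases_nat.
Qed.

Lemma spellable_id n : spellable (c_id n).
Proof. exact (spellable_idto (eq_refl n)). Qed.

(** This is not among the axioms. The hexagon with two trivial factors shows that the swap, cast to
    an endomorphism, is idempotent ([K]); it also has a left inverse ([I1]), so it is the identity
    ([J]). *)
Lemma swap_zero_r n (e : n + 0 = n) : c_swap n 0 ≅ c_idto e.
Proof.
  assert (K : forall e0 : n = n + 0, (c_swap n 0 ;; c_idto e0) ;; (c_swap n 0 ;; c_idto e0)
             ≅ c_swap n 0 ;; c_idto e0).
  { intro e0.
    pose proof (ceq_hexagon n 0 0) as H.
    assert (A1 : c_assoc 0 0 n ≅ c_id n) by apply c_idto_id.
    assert (A2 : c_id 0 [*] c_swap n 0 ≅ c_swap n 0) by apply ceq_lunit.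
    rewrite (ceq_comp (ceq_refl (c_assoc n 0 0 ;; c_swap n (0 + 0))) A1) in H.
    rewrite (ceq_comp (ceq_refl ((c_swap n 0 [*] c_id 0) ;; c_assoc 0 n 0)) A2) in H.
    rewrite (ceq_comp_idr (c_assoc n 0 0 ;; c_swap n (0 + 0))) in H.
    assert (A3 : c_assoc 0 n 0 ≅ c_id (n + 0)) by apply c_idto_id.
    rewrite (ceq_comp (ceq_refl (c_swap n 0 [*] c_id 0)) A3) in H.
    rewrite (ceq_comp_idr (c_swap n 0 [*] c_id 0)) in H.
    pose proof (ceq_runit (c_swap n 0)) as R.
    assert (R' : c_swap n 0 [*] c_id 0 ≅ c_runit (n + 0) ;; c_swap n 0 ;; c_idto e0).
    { rewrite <- R. rewrite ceq_comp_assoc. unfold c_runit. rewrite c_idto_comp.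
      rewrite c_idto_id, ceq_comp_idr. reflexivity. }
    rewrite R' in H.
    assert (A4 : c_assoc n 0 0 ≅ c_runit (n + 0)) by apply c_idto_irrel.
    assert (H' : c_runit (n + 0) ;; c_swap n 0 ≅
                 c_runit (n + 0) ;; c_swap n 0 ;; c_idto e0 ;; c_swap n 0).
    { rewrite <- H. apply ceq_comp; [symmetry; exact A4 | reflexivity]. }
    assert (H2 : c_swap n 0 ≅ c_swap n 0 ;; c_idto e0 ;; c_swap n 0).
    { rewrite <- (ceq_comp_idl (c_swap n 0)) at 1.
      rewrite <- (c_idto_compK (f_equal (fun x => x + 0) e0) (Nat.add_0_r (n + 0))).
      unfold c_runit in H'. rewrite ceq_comp_assoc, H'.
      rewrite <- !ceq_comp_assoc, c_idto_comp, c_idto_id, ceq_comp_idl. reflexivity. }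
    rewrite H2 at 3. rewrite !ceq_comp_assoc. reflexivity. }
  specialize (K (eq_sym e)).
  assert (I1 : (c_idto e ;; c_swap 0 n) ;; (c_swap n 0 ;; c_idto (eq_sym e)) ≅ c_id (n + 0)).
  { rewrite ceq_comp_assoc, <- (ceq_comp_assoc (c_swap 0 n)).
    rewrite (ceq_swapK 0 n), ceq_comp_idl. apply c_idto_compK. }
  assert (J : c_swap n 0 ;; c_idto (eq_sym e) ≅ c_id (n + 0)).
  { etransitivity; [|exact I1]. rewrite <- K at 2.
    rewrite <- (ceq_comp_assoc (c_idto e ;; c_swap 0 n)), I1, ceq_comp_idl. reflexivity. }
  rewrite <- (ceq_comp_idr (c_swap n 0)).
  rewrite <- (c_idto_compK (eq_sym e) e).
  rewrite <- ceq_comp_assoc, J. apply ceq_comp_idl.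
Qed.

Lemma swap_zero_l n (e : n = n + 0) : c_swap 0 n ≅ c_idto e.
Proof.
  rewrite <- (ceq_comp_idr (c_swap 0 n)), <- (c_idto_compK (eq_sym e) e).
  rewrite <- (swap_zero_r (eq_sym e)), <- ceq_comp_assoc.
  rewrite (ceq_swapK 0 n). apply ceq_comp_idl.
Qed.

Lemma spellable_sw k : spellable (sw k).
Proof.
  apply (@spellable_endo _ _ [0]).
  - constructor; [lia | constructor].
  - simpl. symmetry; apply ceq_comp_idr.
  - intros i Hi. simpl. unfold tr. destruct i as [|[|i]]; simpl; lia.
Qed.

Lemma spellable_swap_one m : spellable (c_swap 1 m).
Proof.
  induction m as [|m IH].
  - eapply spellable_ceq; [apply (@swap_zero_r 1 eq_refl)| |apply spellable_idto].
    intros i Hi. simpl. cases_nat.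
  - eapply spellable_ceq; [apply swap_one_succ| |].
    2:{ apply spellable_comp; [apply spellable_sw|].
        apply (@spellable_tens 1 _ 1 _ (c_id 1)); [apply spellable_id | exact IH]. }
    intros i Hi. destruct i as [|[|i]]; simpl; lia.
Qed.

(** The hexagon axiom splits the second argument of a swap. Splitting the first goes through
    inverses: the proposed composite [g] is a left inverse of the split form of [c_swap m (S n)]. *)
Lemma swap_succ n m (e : S (m + n) = S m + n) (e' : m + 1 + n = m + S n) :
  c_swap (S n) m ≅ up (c_swap n m) ;; c_idto e ;; (c_swap 1 m [*] c_id n) ;; c_idto e'.
Proof.
  assert (H : c_swap m (S n) ≅
     c_idto (eq_sym e') ;; (c_swap m 1 [*] c_id n) ;; c_idto (eq_sym e) ;; up (c_swap m n)).
  { pose proof (ceq_hexagon m 1 n) as H.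
    assert (A1 : c_assoc 1 n m ≅ c_id (S (n + m))) by apply c_idto_id.
    rewrite (ceq_comp (ceq_refl (c_assoc m 1 n ;; c_swap m (1 + n))) A1) in H.
    rewrite (ceq_comp_idr (c_assoc m 1 n ;; c_swap m (1 + n))) in H.
    rewrite <- (ceq_comp_idl (c_swap m (S n))).
    rewrite <- (c_idto_compK (eq_sym e') e').
    rewrite ceq_comp_assoc, (c_idto_irrel e' (eq_sym (Nat.add_assoc m 1 n))).
    rewrite (c_idto_irrel (eq_sym e) (eq_sym (Nat.add_assoc 1 m n))).
    rewrite !ceq_comp_assoc. apply ceq_comp; [reflexivity|].
    etransitivity; [exact H|]. apply ceq_comp_assoc. }
  set (g := up (c_swap n m) ;; c_idto e ;; (c_swap 1 m [*] c_id n) ;; c_idto e').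
  assert (K : g ;; c_swap m (S n) ≅ c_id (S n + m)).
  { rewrite H. unfold g. rewrite !ceq_comp_assoc.
    rewrite <- (ceq_comp_assoc (c_idto e')), c_idto_compK, ceq_comp_idl.
    rewrite <- (ceq_comp_assoc (c_swap 1 m [*] c_id n)), <- ceq_tens_comp.
    rewrite (ceq_tens (ceq_swapK 1 m) (ceq_comp_idl (c_id n))), (ceq_tens_id (1 + m) n).
    rewrite ceq_comp_idl.
    rewrite <- (ceq_comp_assoc (c_idto e)), c_idto_compK, ceq_comp_idl.
    etransitivity; [symmetry; apply up_comp|]. rewrite ceq_swapK. apply up_id. }
  rewrite <- (ceq_comp_idl (c_swap (S n) m)), <- K, ceq_comp_assoc, ceq_swapK.
  apply ceq_comp_idr.
Qed.

Lemma spellable_swap n m : spellable (c_swap n m).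
Proof.
  revert m; induction n as [|n IH]; intro m.
  - eapply spellable_ceq; [apply (swap_zero_l (eq_sym (Nat.add_0_r m)))| |apply spellable_idto].
    intros i Hi. rewrite sem_idto. simpl. lia.
  - assert (e : S (m + n) = S m + n) by lia.
    assert (e' : m + 1 + n = m + S n) by lia.
    eapply spellable_ceq; [apply (swap_succ e e')| |].
    2:{ repeat apply spellable_comp; try apply spellable_idto.
        - apply (@spellable_tens 1 _ 1 _ (c_id 1)); [apply spellable_id | apply IH].
        - apply spellable_tens; [apply spellable_swap_one | apply spellable_id]. }
    intros i Hi. cbn -[Nat.ltb Nat.sub]. rewrite !sem_idto. cases_nat.
Qed.

Lemma isperm_spellable n m (f : circ n m) : isperm f -> spellable f.
Proof.
  induction f; simpl; intro H; try contradiction.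
  - apply spellable_id.
  - apply spellable_comp; tauto.
  - apply spellable_tens; tauto.
  - apply spellable_swap.
Qed.

Lemma isperm_eq n m (f : circ n m) : isperm f -> n = m.
Proof. intro H. exact (proj1 (isperm_spellable H)). Qed.

Lemma perm_canon n (f : circ n n) : isperm f -> f ≅ canon n (sem f).
Proof.
  intro H. destruct (isperm_spellable H) as [_ [l Hl]].
  etransitivity; [exact (spelled_endo Hl)|]. destruct Hl as [Hv [_ Hs]].
  rewrite word_canon by auto.
  rewrite (@canon_ext n (wsem l) (sem f)); [reflexivity|].
  intros; symmetry; auto.
Qed.

Theorem perm_coherence n m (f g : circ n m) : isperm f -> isperm g ->
  (forall i, i < n -> sem f i = sem g i) -> f ≅ g.
Proof.
  intros Hf Hg H. pose proof (isperm_eq Hf). subst m.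
  rewrite (perm_canon Hf), (perm_canon Hg), (canon_ext H). reflexivity.
Qed.

(** * The dagger and the cnot gates between arbitrary wires *)

Fixpoint dag n m (f : circ n m) : circ m n :=
  match f with
  | c_id n => c_id n
  | c_comp f g => dag g ;; dag f
  | c_tens f g => dag f [*] dag g
  | c_swap n m => c_swap m n
  | cnot => cnot
  | ket1 => bra1
  | bra1 => ket1
  end.

Lemma dag_dag n m (f : circ n m) : dag (dag f) = f.
Proof. induction f; simpl; congruence. Qed.

Lemma dag_idto n m (e : n = m) : dag (c_idto e) = c_idto (eq_sym e).
Proof. destruct e; reflexivity. Qed.

Lemma isperm_dag n m (f : circ n m) : isperm f -> isperm (dag f).
Proof. induction f; simpl; tauto. Qed.

Lemma perm_dagK n m (f : circ n m) : isperm f -> f ;; dag f ≅ c_id n.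
Proof.
  induction f; simpl; intro H; try contradiction.
  - apply ceq_comp_idl.
  - destruct H as [H1 H2].
    rewrite ceq_comp_assoc, <- (ceq_comp_assoc f2), IHf2, ceq_comp_idl by auto. auto.
  - destruct H as [H1 H2].
    rewrite <- ceq_tens_comp, IHf1, IHf2 by auto. apply ceq_tens_id.
  - apply ceq_swapK.
Qed.

Lemma dag_permK n m (f : circ n m) : isperm f -> dag f ;; f ≅ c_id m.
Proof.
  intro H. pose proof (perm_dagK (isperm_dag H)) as E. rewrite dag_dag in E. exact E.
Qed.

Lemma isperm_canon n q : isperm (canon n q).
Proof.
  assert (Hins : forall k j, isperm (ins k j)).
  { induction k as [|k IH]; intros [|j]; simpl; auto. }
  revert q; induction n as [|n IH]; intro q; simpl; auto.
Qed.

Lemma strict_eq n m (a b : circ n m) : a ;; c_id m ≅ c_id n ;; b -> a ≅ b.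
Proof. rewrite ceq_comp_idl, ceq_comp_idr. auto. Qed.

(** Associativity of the tensor when the outer sums are convertible, so that the
  associators are plain identities. *)
Local Notation tassoc f g h :=
  (strict_eq (@tens_assoc_cast _ _ _ _ _ _ f g h eq_refl eq_refl)).

Lemma tens_split n n' m m' (f : circ n n') (g : circ m m') :
  f [*] g ≅ (f [*] c_id m) ;; (c_id n' [*] g).
Proof. rewrite <- ceq_tens_comp, ceq_comp_idl, ceq_comp_idr. reflexivity. Qed.

Lemma tens_split' n n' m m' (f : circ n n') (g : circ m m') :
  f [*] g ≅ (c_id n [*] g) ;; (f [*] c_id m').
Proof. rewrite <- ceq_tens_comp, ceq_comp_idl, ceq_comp_idr. reflexivity. Qed.

Lemma tens_comp_l n n' n'' m (f : circ n n') (g : circ n' n'') :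
  (f ;; g) [*] c_id m ≅ (f [*] c_id m) ;; (g [*] c_id m).
Proof. rewrite <- ceq_tens_comp, ceq_comp_idl. reflexivity. Qed.

Lemma tens_comp_r n m m' m'' (f : circ m m') (g : circ m' m'') :
  c_id n [*] (f ;; g) ≅ (c_id n [*] f) ;; (c_id n [*] g).
Proof. rewrite <- ceq_tens_comp, ceq_comp_idl. reflexivity. Qed.

Definition pconj n (p a : circ n n) := p ;; a ;; dag p.

#[local] Instance conj_proper n (p : circ n n) : Proper (@ceq n n ==> @ceq n n) (pconj p).
Proof. intros a b H. unfold pconj. rewrite H. reflexivity. Qed.

Lemma conj_comp n (p a b : circ n n) : isperm p ->
  pconj p (a ;; b) ≅ pconj p a ;; pconj p b.
Proof.
  intro H. unfold pconj. rewrite !ceq_comp_assoc, <- (ceq_comp_assoc (dag p) p).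
  rewrite (dag_permK H), ceq_comp_idl. reflexivity.
Qed.

Lemma conj_move n (p a : circ n n) : isperm p -> p ;; a ≅ pconj p a ;; p.
Proof.
  intro H. unfold pconj. rewrite !ceq_comp_assoc, (dag_permK H), ceq_comp_idr. reflexivity.
Qed.

(** [cnot_at p] is the cnot gate whose control and target are the wires which [p] moves
  to positions [0] and [1]. *)
Definition cnot_at k (p : circ (S (S k)) (S (S k))) : circ (S (S k)) (S (S k)) :=
  pconj p (cnot [*] c_id k).

(** The permutation [r] from [q] to [p] fixes wires 0 and 1, so its normal form is [c_id 2 [*] c],
    which commutes with a cnot on those two wires. A conjugated cnot thus depends only on its
    control and target. *)
Lemma cnot_at_eq k (p q : circ (S (S k)) (S (S k))) : isperm p -> isperm q ->
  sem p (sem (dag q) 0) = 0 -> sem p (sem (dag q) 1) = 1 -> cnot_at p ≅ cnot_at q.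
Proof.
  intros Hp Hq H0 H1. set (r := dag q ;; p).
  assert (Hr : isperm r) by (split; auto using isperm_dag).
  assert (Er : exists c, r ≅ c_id 2 [*] c).
  { eexists. etransitivity; [apply (perm_canon Hr)|]. simpl.
    rewrite H0, H1. unfold unbump at 2. simpl. rewrite !ins0.
    rewrite ceq_comp_idr, ceq_comp_idr. apply up_up. }
  destruct Er as [c Er].
  assert (Ep : p ≅ q ;; r).
  { unfold r. rewrite <- ceq_comp_assoc, (perm_dagK Hq), ceq_comp_idl. reflexivity. }
  assert (Ed : r ;; dag p ≅ dag q).
  { unfold r. rewrite ceq_comp_assoc, (perm_dagK Hp), ceq_comp_idr. reflexivity. }
  assert (Ec : r ;; (cnot [*] c_id k) ≅ (cnot [*] c_id k) ;; r).
  { rewrite Er. symmetry. apply (tens_interchange cnot c). }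
  unfold cnot_at, pconj. rewrite Ep at 1. rewrite (ceq_comp_assoc q r), Ec.
  rewrite !ceq_comp_assoc, Ed. reflexivity.
Qed.

Lemma conj_cnot_at k (p q : circ (S (S k)) (S (S k))) : pconj p (cnot_at q) ≅ cnot_at (p ;; q).
Proof. unfold cnot_at, pconj. simpl. rewrite !ceq_comp_assoc. reflexivity. Qed.

(** Wire [i] goes to 0, wire [j] to 1, and the others follow from 2 on in their old order. *)
Definition pos i j x :=
  if x =? i then 0 else if x =? j then 1
  else 2 + x - (if i <? x then 1 else 0) - (if j <? x then 1 else 0).

(** Here [k] counts the spectator wires, and control [i] and target [j] are numbered from 0, whereas
    names such as [C3_12] number from 1. *)
Definition gate k i j := cnot_at (canon (S (S k)) (pos i j)).

Local Notation C3 := (gate 1).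
Local Notation C4 := (gate 2).

Lemma cnot_at_gate k (p : circ (S (S k)) (S (S k))) i j : isperm p ->
  sem p (sem (dag (canon (S (S k)) (pos i j))) 0) = 0 ->
  sem p (sem (dag (canon (S (S k)) (pos i j))) 1) = 1 -> cnot_at p ≅ gate k i j.
Proof. intros. apply cnot_at_eq; auto using isperm_canon. Qed.

Lemma conj_gate k (p : circ (S (S k)) (S (S k))) i j i' j' : isperm p ->
  let q := p ;; canon (S (S k)) (pos i j) in
  sem q (sem (dag (canon (S (S k)) (pos i' j'))) 0) = 0 ->
  sem q (sem (dag (canon (S (S k)) (pos i' j'))) 1) = 1 ->
  pconj p (gate k i j) ≅ gate k i' j'.
Proof.
  intros Hp q H0 H1. unfold gate at 1. rewrite conj_cnot_at.
  apply cnot_at_gate; auto. split; auto using isperm_canon.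
Qed.

Ltac gate_compute :=
  first [exact I | repeat split; vm_compute; reflexivity | auto using isperm_canon].

Lemma cnot_C3_01 : C3_12 ≅ C3 0 1.
Proof.
  transitivity (cnot_at (c_id 3)).
  - unfold cnot_at, pconj. simpl. rewrite ceq_comp_idl, ceq_comp_idr. reflexivity.
  - apply cnot_at_gate; gate_compute.
Qed.

Lemma cnot_C3_10 : C3_21 ≅ C3 1 0.
Proof.
  transitivity (cnot_at (sw 1)).
  - unfold cnot_at, pconj, C3_21, C2_21, sw. rewrite !tens_comp_l.
    simpl. reflexivity.
  - apply cnot_at_gate; gate_compute.
Qed.

Lemma cnot_C3_12 : C3_23 ≅ C3 1 2.
Proof.
  transitivity (cnot_at (c_swap 1 2)).
  - unfold cnot_at, pconj. simpl.
    pose proof (ceq_swap_nat (c_id 1) cnot) as E.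
    rewrite <- E. rewrite ceq_comp_assoc, (ceq_swapK 1 2). symmetry. apply ceq_comp_idr.
  - apply cnot_at_gate; gate_compute.
Qed.

Lemma cnot_C3_21 : C3_32 ≅ C3 2 1.
Proof.
  transitivity (pconj (up sigma) (C3 1 2)).
  - unfold pconj. rewrite <- cnot_C3_12. unfold C3_32, C2_21. rewrite !tens_comp_r.
    simpl. reflexivity.
  - apply conj_gate; gate_compute.
Qed.

Lemma cnot_C3_02 : C3_13 ≅ C3 0 2.
Proof.
  transitivity (pconj (sw 1) (C3 1 2)).
  - unfold pconj, C3_13. rewrite <- cnot_C3_12. reflexivity.
  - apply conj_gate; gate_compute.
Qed.

Lemma C3_control_comm : C3 0 1 ;; C3 0 2 ≅ C3 0 2 ;; C3 0 1.
Proof.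
  assert (E : C3 1 0 ;; C3 1 2 ≅ C3 1 2 ;; C3 1 0).
  { rewrite <- cnot_C3_10, <- cnot_C3_12. apply ceq_rel, CNT3. }
  apply (conj_proper (sw 1)) in E. rewrite !conj_comp in E by gate_compute.
  rewrite (@conj_gate 1 (sw 1) 1 0 0 1), (@conj_gate 1 (sw 1) 1 2 0 2) in E by gate_compute.
  exact E.
Qed.

Lemma C3_target_comm : C3 0 2 ;; C3 1 2 ≅ C3 1 2 ;; C3 0 2.
Proof.
  assert (E : C3 0 1 ;; C3 2 1 ≅ C3 2 1 ;; C3 0 1).
  { rewrite <- cnot_C3_01, <- cnot_C3_21. apply ceq_rel, CNT5. }
  apply (conj_proper (up (sw 0))) in E. rewrite !conj_comp in E by gate_compute.
  rewrite (@conj_gate 1 (up (sw 0)) 0 1 0 2), (@conj_gate 1 (up (sw 0)) 2 1 1 2) in E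
    by gate_compute.
  exact E.
Qed.

Lemma cnot_cnot : cnot ;; cnot ≅ c_id 2.
Proof. apply ceq_rel, CNT2. Qed.

(** CNT.8 with the involution [C3 0 1] cancelled on the right. In the arguments below this is what
    exchanges two chained cnots, at the price of a third one. *)
Lemma C3_chain : C3 0 1 ;; C3 1 2 ≅ C3 1 2 ;; C3 0 2 ;; C3 0 1.
Proof.
  rewrite <- cnot_C3_01, <- cnot_C3_12, <- cnot_C3_02.
  rewrite <- (ceq_rel CNT8). rewrite !ceq_comp_assoc.
  assert (E : C3_12 ;; C3_12 ≅ c_id 3).
  { etransitivity; [symmetry; apply (tens_comp_l 1 cnot cnot)|].
    etransitivity; [exact (ceq_tens cnot_cnot (ceq_refl (c_id 1))) | apply (ceq_tens_id 2 1)]. }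
  rewrite E, ceq_comp_idr. reflexivity.
Qed.

Lemma move_casts n m n' m' (a : circ n m) (b : circ n' m') (e : n = n') (e' : m = m') :
  a ;; c_idto e' ≅ c_idto e ;; b -> c_idto (eq_sym e) ;; a ≅ b ;; c_idto (eq_sym e').
Proof. destruct e, e'. simpl. rewrite !ceq_comp_idl, !ceq_comp_idr. auto. Qed.

(** The relations are closed under reflection: the halves of CNT.4 and of CNT.7 trade places, and
    the others are symmetric up to order. The reflection of CNT.8 has its two final gates reversed,
    which [C3_target_comm] repairs. *)
Lemma dag_rel n m (f g : circ n m) : cnot_rel f g -> dag f ≅ dag g.
Proof.
  assert (R2 : dag C2_21 ≅ C2_21)
    by (simpl; unfold C2_21; rewrite ceq_comp_assoc; reflexivity).
  assert (R21 : dag C3_21 ≅ C3_21) by (unfold C3_21; simpl dag; rewrite <- R2; reflexivity).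
  assert (R32 : dag C3_32 ≅ C3_32) by (unfold C3_32; simpl dag; rewrite <- R2; reflexivity).
  assert (R13 : dag C3_13 ≅ C3_13)
    by (unfold C3_13; simpl dag; rewrite ceq_comp_assoc; reflexivity).
  destruct 1.
  - change (C2_12 ;; (dag C2_21 ;; C2_12) ≅ sigma).
    rewrite R2, <- ceq_comp_assoc. apply ceq_rel, CNT1.
  - apply ceq_rel, CNT2.
  - change (C3_23 ;; dag C3_21 ≅ dag C3_21 ;; C3_23).
    rewrite R21. symmetry. apply ceq_rel, CNT3.
  - change (C2_12 ;; (bra1 [*] c_id 1) ≅
     (bra1 [*] c_id 1) ;; ((ket1 [*] c_id 1) ;; (C2_12 ;; (bra1 [*] c_id 1)))).
    rewrite <- !ceq_comp_assoc. apply ceq_rel, CNT4b.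
  - change ((ket1 [*] c_id 1) ;; C2_12 ≅
     (ket1 [*] c_id 1) ;; (C2_12 ;; ((bra1 [*] c_id 1) ;; (ket1 [*] c_id 1)))).
    rewrite <- !ceq_comp_assoc. apply ceq_rel, CNT4a.
  - change (dag C3_32 ;; C3_12 ≅ C3_12 ;; dag C3_32).
    rewrite R32. symmetry. apply ceq_rel, CNT5.
  - apply ceq_rel, CNT6.
  - change ((ket1 [*] c_id 2) ;; (C3_23 ;; (C3_12 ;; (bra1 [*] bra1 [*] c_id 1))) ≅
      (ket1 [*] c_id 2) ;; (C3_12 ;; (bra1 [*] bra1 [*] c_id 1))).
    rewrite <- !ceq_comp_assoc. apply ceq_rel, CNT7b.
  - change ((ket1 [*] ket1 [*] c_id 1) ;; (C3_12 ;; (C3_23 ;; (bra1 [*] c_id 2))) ≅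
      (ket1 [*] ket1 [*] c_id 1) ;; (C3_12 ;; (bra1 [*] c_id 2))).
    rewrite <- !ceq_comp_assoc. apply ceq_rel, CNT7a.
  - change (C3_12 ;; (C3_23 ;; C3_12) ≅ dag C3_13 ;; C3_23).
    rewrite R13, <- ceq_comp_assoc, (ceq_rel CNT8), cnot_C3_02, cnot_C3_12.
    symmetry. apply C3_target_comm.
  - simpl dag. rewrite <- !ceq_comp_assoc. apply ceq_rel, CNT9.
Qed.

Lemma dag_ceq n m (f g : circ n m) : f ≅ g -> dag f ≅ dag g.
Proof.
  induction 1; simpl.
  - reflexivity.
  - symmetry; assumption.
  - etransitivity; eassumption.
  - apply ceq_comp; assumption.
  - apply ceq_tens; assumption.
  - apply ceq_comp_idr.
  - apply ceq_comp_idl.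
  - symmetry; apply ceq_comp_assoc.
  - apply ceq_tens_id.
  - apply ceq_tens_comp.
  - unfold c_assoc. rewrite !dag_idto. apply move_casts, tens_assoc_cast.
  - apply ceq_lunit.
  - unfold c_runit. rewrite !dag_idto. apply move_casts, ceq_runit.
  - symmetry. apply ceq_swap_nat.
  - apply ceq_swapK.
  (* The reflected hexagon is the one for inverse braidings, not an axiom; coherence supplies it. *)
  - unfold c_assoc. rewrite !dag_idto. apply perm_coherence; simpl;
      auto using isperm_idto.
    intros i Hi. rewrite !sem_idto. cases_nat.
  - apply dag_rel; assumption.
Qed.

#[local] Instance dag_proper n m : Proper (@ceq n m ==> @ceq m n) (@dag n m).
Proof. intros f g H. apply dag_ceq, H. Qed.

(** * Negation, the state |0> and the copy of one wire *)

Definition not1 : circ 1 1 := (ket1 [*] c_id 1) ;; cnot ;; (bra1 [*] c_id 1).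
Definition ket0 : circ 0 1 := ket1 ;; not1.
Definition bra0 : circ 1 0 := dag ket0.

(** CNT.4 keeps a control prepared as |1> intact through the gate, so the gate only negates its
    target. *)
Lemma ket1_cnot : (ket1 [*] c_id 1) ;; cnot ≅ not1 ;; (ket1 [*] c_id 1).
Proof. apply (ceq_rel CNT4a). Qed.

Lemma cnot_bra1 : cnot ;; (bra1 [*] c_id 1) ≅ (bra1 [*] c_id 1) ;; not1.
Proof. unfold not1. rewrite <- !ceq_comp_assoc. apply (ceq_rel CNT4b). Qed.

Lemma not1_not1 : not1 ;; not1 ≅ c_id 1.
Proof.
  unfold not1 at 2. rewrite <- !ceq_comp_assoc.
  etransitivity;
    [exact (ceq_comp (ceq_comp (ceq_sym ket1_cnot) (ceq_refl _)) (ceq_refl _))|].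
  rewrite (ceq_comp_assoc _ cnot cnot), cnot_cnot, ceq_comp_idr.
  etransitivity; [symmetry; apply (tens_comp_l 1 ket1 bra1)|].
  etransitivity; [refine (ceq_tens (ceq_rel CNT6) (ceq_refl (c_id 1)))|].
  apply ceq_lunit.
Qed.

Lemma dag_not1 : dag not1 ≅ not1.
Proof. unfold not1. simpl. rewrite ceq_comp_assoc. reflexivity. Qed.

Lemma ket0_bra0 : ket0 ;; bra0 ≅ c_id 0.
Proof.
  unfold bra0, ket0. change (ket1 ;; not1 ;; (dag not1 ;; bra1) ≅ c_id 0).
  rewrite dag_not1, ceq_comp_assoc, <- (ceq_comp_assoc not1), not1_not1, ceq_comp_idl.
  apply (ceq_rel CNT6).
Qed.

Lemma ket0_not1 : ket0 ;; not1 ≅ ket1.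
Proof. unfold ket0. rewrite ceq_comp_assoc, not1_not1. apply ceq_comp_idr. Qed.

Lemma ket_tens n m (f : circ 0 n) (g : circ 0 m) : f [*] g ≅ g ;; (f [*] c_id m).
Proof.
  etransitivity; [apply (tens_split' f g)|]. apply ceq_comp; [apply ceq_lunit | reflexivity].
Qed.

(** This is CNT.7 in disguise: its shorter side is [ket0 [*] c_id 1] by [E], and its longer side is
    the same map followed by a cnot. *)
Lemma ket0_cnot : (ket0 [*] c_id 1) ;; cnot ≅ ket0 [*] c_id 1.
Proof.
  assert (E : (ket1 [*] ket1 [*] c_id 1) ;; C3_12 ;; (bra1 [*] c_id 2) ≅ ket0 [*] c_id 1).
  { assert (E1 : bra1 [*] c_id 2 ≅ (bra1 [*] c_id 1) [*] c_id 1).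
    { etransitivity; [|symmetry; exact (tassoc bra1 (c_id 1) (c_id 1))].
      tens_congr; [reflexivity|]. symmetry. apply (ceq_tens_id 1 1). }
    rewrite E1.
    transitivity (((ket1 [*] ket1) ;; cnot ;; (bra1 [*] c_id 1)) [*] c_id 1).
    - etransitivity; [|symmetry; apply (tens_comp_l 1 ((ket1 [*] ket1) ;; cnot) (bra1 [*] c_id 1))].
      apply ceq_comp; [|reflexivity]. symmetry.
      apply (tens_comp_l 1 (ket1 [*] ket1) cnot).
    - tens_congr; [|reflexivity]. unfold ket0, not1.
      rewrite <- !ceq_comp_assoc. rewrite (ket_tens ket1 ket1). reflexivity. }
  pose proof (ceq_rel CNT7a) as H. rewrite E in H. rewrite <- H at 2.
  assert (F : C3_23 ;; (bra1 [*] c_id 2) ≅ (bra1 [*] c_id 2) ;; cnot).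
  { etransitivity; [symmetry; apply (tens_interchange bra1 cnot)|].
    apply ceq_comp; [reflexivity | apply ceq_lunit]. }
  rewrite (ceq_comp_assoc _ C3_23), F, <- ceq_comp_assoc.
  apply ceq_comp; [symmetry; exact E | reflexivity].
Qed.

Definition delta : circ 1 2 := (c_id 1 [*] ket0) ;; cnot.

Lemma sigma_zero_r n (f : circ 0 n) : (c_id 1 [*] f) ;; c_swap 1 n ≅ f [*] c_id 1.
Proof.
  etransitivity; [apply (ceq_swap_nat (c_id 1) f)|].
  etransitivity; [apply ceq_comp; [apply (@swap_zero_r 1 eq_refl) | reflexivity]|].
  apply ceq_comp_idl.
Qed.

Lemma sigma_zero_l n (f : circ 0 n) : (f [*] c_id 1) ;; c_swap n 1 ≅ c_id 1 [*] f.
Proof.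
  rewrite <- sigma_zero_r, ceq_comp_assoc, ceq_swapK. apply ceq_comp_idr.
Qed.

Lemma delta_total : delta ;; dag delta ≅ c_id 1.
Proof.
  unfold delta. change ((c_id 1 [*] ket0) ;; cnot ;; (cnot ;; (c_id 1 [*] bra0)) ≅ c_id 1).
  rewrite ceq_comp_assoc, <- (ceq_comp_assoc cnot), cnot_cnot, ceq_comp_idl.
  etransitivity; [symmetry; apply (tens_comp_r 1 ket0 bra0)|].
  etransitivity; [exact (ceq_tens (ceq_refl (c_id 1)) ket0_bra0) | apply (ceq_tens_id 1 0)].
Qed.

(** Expand [sigma] into three cnots by CNT.1. The first cancels the cnot of [delta], the second has
    control |0> and vanishes, and the third rebuilds [delta]. *)
Lemma delta_cocomm : delta ;; sigma ≅ delta.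
Proof.
  rewrite <- (ceq_rel CNT1) at 1. unfold delta, C2_12, C2_21.
  rewrite !ceq_comp_assoc, <- (ceq_comp_assoc cnot cnot), cnot_cnot, ceq_comp_idl.
  rewrite <- !ceq_comp_assoc.
  apply ceq_comp; [|reflexivity].
  rewrite (sigma_zero_r ket0), ket0_cnot. apply sigma_zero_l.
Qed.

Lemma bra_tens_ket n m (f : circ n 0) (g : circ 0 m) :
  f [*] g ≅ (f [*] c_id 0) ;; g.
Proof.
  etransitivity; [apply tens_split|]. apply ceq_comp; [reflexivity | apply ceq_lunit].
Qed.

Lemma tens_id0_cast n m (f : circ n m) (e : n + 0 = n) (e' : m + 0 = m) :
  (f [*] c_id 0) ;; c_idto e' ≅ c_idto e ;; f.
Proof.
  rewrite (c_idto_irrel e (Nat.add_0_r n)), (c_idto_irrel e' (Nat.add_0_r m)).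
  apply ceq_runit.
Qed.

Lemma tens_id0_bra (f : circ 1 0) : f [*] c_id 0 ≅ f.
Proof. exact (strict_eq (@tens_id0_cast 1 0 f eq_refl eq_refl)). Qed.

Lemma tens_id0_ket (f : circ 0 1) : f [*] c_id 0 ≅ f.
Proof. exact (strict_eq (@tens_id0_cast 0 1 f eq_refl eq_refl)). Qed.

Lemma delta_bra1 : delta ;; (bra1 [*] c_id 1) ≅ bra1 ;; ket1.
Proof.
  unfold delta. rewrite ceq_comp_assoc, cnot_bra1, <- ceq_comp_assoc.
  assert (E : (c_id 1 [*] ket0) ;; (bra1 [*] c_id 1) ≅ bra1 ;; ket0).
  { etransitivity; [symmetry; apply (tens_split' bra1 ket0)|].
    etransitivity; [apply (bra_tens_ket bra1 ket0)|].
    apply ceq_comp; [apply tens_id0_bra | reflexivity]. }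
  rewrite E, ceq_comp_assoc, ket0_not1. reflexivity.
Qed.

Lemma ket1_delta : ket1 ;; delta ≅ ket1 [*] ket1.
Proof.
  unfold delta. rewrite <- ceq_comp_assoc.
  assert (E : ket1 ;; (c_id 1 [*] ket0) ≅ ket0 ;; (ket1 [*] c_id 1)).
  { etransitivity; [|apply (ket_tens ket1 ket0)].
    etransitivity; [|symmetry; apply (tens_split ket1 ket0)].
    apply ceq_comp; [symmetry; apply tens_id0_ket | reflexivity]. }
  rewrite E, ceq_comp_assoc, ket1_cnot, <- ceq_comp_assoc, ket0_not1.
  symmetry. apply (ket_tens ket1 ket1).
Qed.

Definition mid0 : circ 2 3 := up (ket0 [*] c_id 1).
Definition last0 : circ 2 3 := up (c_id 1 [*] ket0).

Lemma mid0_C3 : mid0 ;; C3 1 2 ≅ mid0.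
Proof.
  rewrite <- cnot_C3_12. unfold mid0.
  etransitivity; [symmetry; apply (up_comp (ket0 [*] c_id 1) cnot)|].
  apply up_proper, ket0_cnot.
Qed.

Lemma last0_sigma : last0 ;; up sigma ≅ mid0.
Proof.
  unfold last0. etransitivity; [symmetry; apply (up_comp (c_id 1 [*] ket0) sigma)|].
  apply up_proper, (sigma_zero_r ket0).
Qed.

Lemma up_tens_id1 n m (f : circ n m) : up (c_id 1 [*] f) ≅ c_id 2 [*] f.
Proof. apply up_up. Qed.

Lemma cnot_tens_id0 : cnot [*] c_id 0 ≅ cnot.
Proof. exact (strict_eq (@tens_id0_cast 2 2 cnot eq_refl eq_refl)). Qed.

Lemma cnot_last0 : cnot ;; last0 ≅ last0 ;; C3 0 1.
Proof.
  unfold last0. rewrite (up_tens_id1 ket0), <- cnot_C3_01.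
  etransitivity; [|apply (tens_interchange cnot ket0)].
  apply ceq_comp; [symmetry; apply cnot_tens_id0 | reflexivity].
Qed.

Lemma cnot_mid0 : cnot ;; mid0 ≅ mid0 ;; C3 0 2.
Proof.
  rewrite <- last0_sigma, <- ceq_comp_assoc, cnot_last0, !ceq_comp_assoc.
  apply ceq_comp; [reflexivity|].
  rewrite (@conj_move 3 (up sigma)) by gate_compute.
  rewrite (@conj_gate 1 (up sigma) 0 2 0 1) by gate_compute. reflexivity.
Qed.

Lemma delta_tens_id1 : delta [*] c_id 1 ≅ mid0 ;; C3 0 1.
Proof.
  rewrite <- cnot_C3_01. unfold delta.
  etransitivity; [apply (tens_comp_l 1 (c_id 1 [*] ket0) cnot)|].
  apply ceq_comp; [|reflexivity]. exact (tassoc (c_id 1) ket0 (c_id 1)).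
Qed.

Lemma id1_tens_delta : c_id 1 [*] delta ≅ last0 ;; C3 1 2.
Proof.
  rewrite <- cnot_C3_12. apply (tens_comp_r 1 (c_id 1 [*] ket0) cnot).
Qed.

Lemma up_ket0_mid0 : up ket0 ;; last0 ≅ up ket0 ;; mid0.
Proof.
  unfold last0, mid0.
  etransitivity; [symmetry; apply (up_comp ket0 (c_id 1 [*] ket0))|].
  etransitivity; [|apply (up_comp ket0 (ket0 [*] c_id 1))].
  apply up_proper. etransitivity; [|apply (ket_tens ket0 ket0)].
  etransitivity; [|symmetry; apply (tens_split ket0 ket0)].
  apply ceq_comp; [symmetry; apply tens_id0_ket | reflexivity].
Qed.

(** Both sides create two |0> wires. On the left [C3_chain] turns [C3 0 1 ;; C3 1 2] into
    [C3 1 2 ;; C3 0 2 ;; C3 0 1], whose first gate is controlled by |0> and vanishes; what remains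
    is the right side. *)
Lemma delta_coassoc : delta ;; (c_id 1 [*] delta) ≅ delta ;; (delta [*] c_id 1).
Proof.
  rewrite id1_tens_delta, delta_tens_id1.
  change delta with (up ket0 ;; cnot). rewrite !ceq_comp_assoc.
  rewrite <- (ceq_comp_assoc cnot mid0), cnot_mid0.
  rewrite <- (ceq_comp_assoc cnot last0), cnot_last0.
  rewrite (ceq_comp_assoc last0), C3_chain, <- !ceq_comp_assoc, up_ket0_mid0.
  rewrite (ceq_comp_assoc (up ket0) mid0 (C3 1 2)), mid0_C3. reflexivity.
Qed.

(** The same exchange by [C3_chain] lets the middle |0> absorb [C3 1 2]. Then [C3 0 2] slides out in
    front and [C3 0 1] out behind, each becoming a plain cnot, and [E3] joins the preparation to the
    discarding in between. *)
Lemma delta_frob :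
  (delta [*] c_id 1) ;; (c_id 1 [*] dag delta) ≅ dag delta ;; delta.
Proof.
  set (v := dag last0).
  assert (E1 : c_id 1 [*] dag delta ≅ C3 1 2 ;; v).
  { rewrite <- cnot_C3_12. apply (tens_comp_r 1 cnot (c_id 1 [*] bra0)). }
  assert (E2 : C3 0 1 ;; v ≅ v ;; cnot).
  { pose proof (dag_ceq cnot_last0) as H. rewrite <- cnot_C3_01 in H.
    simpl dag in H. rewrite <- cnot_C3_01. symmetry. exact H. }
  assert (E3 : mid0 ;; v ≅ (c_id 1 [*] bra0) ;; (c_id 1 [*] ket0)).
  { etransitivity; [symmetry; apply (up_comp (ket0 [*] c_id 1) (c_id 1 [*] bra0))|].
    etransitivity; [|apply (tens_comp_r 1 bra0 ket0)].
    apply up_proper.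
    etransitivity; [symmetry; apply (tens_split ket0 bra0)|].
    etransitivity; [apply (tens_split' ket0 bra0)|].
    apply ceq_comp; [apply ceq_lunit | apply tens_id0_ket]. }
  rewrite delta_tens_id1, E1, ceq_comp_assoc, <- (ceq_comp_assoc (C3 0 1)), C3_chain.
  rewrite <- !ceq_comp_assoc, mid0_C3, <- cnot_mid0, !ceq_comp_assoc, E2.
  rewrite <- (ceq_comp_assoc mid0), E3.
  change (dag delta ;; delta)
    with (cnot ;; (c_id 1 [*] bra0) ;; ((c_id 1 [*] ket0) ;; cnot)).
  rewrite !ceq_comp_assoc. reflexivity.
Qed.

(** * Gates on four wires and naturality of copying for cnot *)

Definition lift (q : circ 4 4) (a : circ 3 3) : circ 4 4 := pconj q (a [*] c_id 1).

#[local] Instance lift_proper (q : circ 4 4) : Proper (@ceq 3 3 ==> @ceq 4 4) (lift q).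
Proof.
  intros a b H. apply conj_proper. exact (ceq_tens H (ceq_refl (c_id 1))).
Qed.

Lemma lift_comp q a b : isperm q -> lift q (a ;; b) ≅ lift q a ;; lift q b.
Proof.
  intro H. unfold lift. rewrite <- (conj_comp _ _ H). apply conj_proper.
  apply (tens_comp_l 1 a b).
Qed.

Lemma lift_gate (q : circ 4 4) i j i' j' : isperm q ->
  let p := q ;; (canon 3 (pos i j) [*] c_id 1) in
  sem p (sem (dag (canon 4 (pos i' j'))) 0) = 0 ->
  sem p (sem (dag (canon 4 (pos i' j'))) 1) = 1 ->
  lift q (C3 i j) ≅ C4 i' j'.
Proof.
  intros Hq p H0 H1. rewrite <- (@cnot_at_gate 2 p i' j'); auto.
  2:{ exact (conj Hq (conj (isperm_canon 3 (pos i j)) I)). }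
  unfold p. etransitivity; [|apply (@conj_cnot_at 2 q (canon 3 (pos i j) [*] c_id 1))].
  apply conj_proper. unfold gate, cnot_at, pconj.
  set (c := canon 3 (pos i j)).
  etransitivity; [apply (tens_comp_l 1 (c ;; (cnot [*] c_id 1)) (dag c))|].
  apply ceq_comp; [|reflexivity].
  etransitivity; [apply (tens_comp_l 1 c (cnot [*] c_id 1))|].
  apply ceq_comp; [reflexivity|].
  etransitivity; [exact (tassoc cnot (c_id 1) (c_id 1))|].
  tens_congr; [reflexivity | apply (ceq_tens_id 1 1)].
Qed.

(** With only four wires, the default 3 catches the spectator, so conjugation by this permutation
    spreads a three-wire identity over wires [a], [b], [c]. *)
Definition pick3 a b c x :=
  if x =? a then 0 else if x =? b then 1 else if x =? c then 2 else 3.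

Ltac lift_relation H a b c :=
  let E := fresh in
  assert (E := lift_proper (canon 4 (pick3 a b c)) H);
  rewrite !lift_comp in E by apply isperm_canon;
  rewrite ?(@lift_gate (canon 4 (pick3 a b c)) 0 1 a b) in E by gate_compute;
  rewrite ?(@lift_gate (canon 4 (pick3 a b c)) 0 2 a c) in E by gate_compute;
  rewrite ?(@lift_gate (canon 4 (pick3 a b c)) 1 2 b c) in E by gate_compute;
  exact E.

Lemma C4_chain013 : C4 0 1 ;; C4 1 3 ≅ C4 1 3 ;; C4 0 3 ;; C4 0 1.
Proof. lift_relation C3_chain 0 1 3. Qed.

Lemma C4_chain023 : C4 0 2 ;; C4 2 3 ≅ C4 2 3 ;; C4 0 3 ;; C4 0 2.
Proof. lift_relation C3_chain 0 2 3. Qed.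

Lemma C4_control013 : C4 0 1 ;; C4 0 3 ≅ C4 0 3 ;; C4 0 1.
Proof. lift_relation C3_control_comm 0 1 3. Qed.

Lemma C4_control012 : C4 0 1 ;; C4 0 2 ≅ C4 0 2 ;; C4 0 1.
Proof. lift_relation C3_control_comm 0 1 2. Qed.

Lemma C4_target023 : C4 0 3 ;; C4 2 3 ≅ C4 2 3 ;; C4 0 3.
Proof. lift_relation C3_target_comm 0 2 3. Qed.

Lemma C4_target123 : C4 1 3 ;; C4 2 3 ≅ C4 2 3 ;; C4 1 3.
Proof. lift_relation C3_target_comm 1 2 3. Qed.

Lemma cnot_C4_01 : cnot [*] c_id 2 ≅ C4 0 1.
Proof.
  transitivity (cnot_at (c_id 4)).
  - unfold cnot_at, pconj. simpl. rewrite ceq_comp_idl, ceq_comp_idr. reflexivity.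
  - apply cnot_at_gate; gate_compute.
Qed.

Lemma cnot_C4_23 : c_id 2 [*] cnot ≅ C4 2 3.
Proof.
  transitivity (cnot_at (c_swap 2 2)).
  - unfold cnot_at, pconj. simpl. rewrite <- (ceq_swap_nat (c_id 2) cnot).
    rewrite ceq_comp_assoc, (ceq_swapK 2 2). symmetry. apply ceq_comp_idr.
  - apply cnot_at_gate; gate_compute.
Qed.

Lemma cnot_tens_cnot : cnot [*] cnot ≅ C4 0 1 ;; C4 2 3.
Proof. rewrite <- cnot_C4_01, <- cnot_C4_23. apply (tens_split cnot cnot). Qed.

Lemma C4_disjoint0123 : C4 0 1 ;; C4 2 3 ≅ C4 2 3 ;; C4 0 1.
Proof. rewrite <- cnot_C4_01, <- cnot_C4_23. apply (tens_interchange cnot cnot). Qed.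

Definition mids : circ 4 4 := up (sw 1).

Lemma C4_disjoint0213 : C4 0 2 ;; C4 1 3 ≅ C4 1 3 ;; C4 0 2.
Proof.
  assert (E := conj_proper mids C4_disjoint0123).
  rewrite !conj_comp in E by gate_compute.
  rewrite (@conj_gate 2 mids 0 1 0 2), (@conj_gate 2 mids 2 3 1 3) in E by gate_compute.
  exact E.
Qed.

(** The inputs land on wires 0 and 2, the fresh |0> on wires 1 and 3. *)
Definition zeros : circ 2 4 := (c_id 1 [*] ket0) [*] (c_id 1 [*] ket0).

Lemma zeros_mids : zeros ≅ (c_id 2 [*] (ket0 [*] ket0)) ;; mids.
Proof.
  assert (E : zeros ≅ up (((ket0 [*] c_id 1) [*] ket0))).
  { etransitivity; [exact (tassoc (c_id 1) ket0 (c_id 1 [*] ket0))|].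
    apply up_proper. symmetry. exact (tassoc ket0 (c_id 1) ket0). }
  rewrite E, <- (up_tens_id1 (ket0 [*] ket0)). unfold mids.
  etransitivity; [|apply (up_comp (c_id 1 [*] (ket0 [*] ket0)) (sw 1))].
  apply up_proper.
  transitivity (((c_id 1 [*] ket0) [*] ket0) ;; (sigma [*] c_id 1)).
  - rewrite <- ceq_tens_comp, ceq_comp_idr.
    tens_congr; [symmetry; apply (sigma_zero_r ket0) | reflexivity].
  - apply ceq_comp; [exact (tassoc (c_id 1) ket0 ket0) | reflexivity].
Qed.

Lemma cnot_zeros : cnot ;; zeros ≅ zeros ;; C4 0 2.
Proof.
  rewrite zeros_mids, <- ceq_comp_assoc.
  assert (E : cnot ;; (c_id 2 [*] (ket0 [*] ket0)) ≅ (c_id 2 [*] (ket0 [*] ket0)) ;; C4 0 1).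
  { rewrite <- cnot_C4_01. etransitivity; [|apply (tens_interchange cnot (ket0 [*] ket0))].
    apply ceq_comp; [symmetry; apply cnot_tens_id0 | reflexivity]. }
  rewrite E, !ceq_comp_assoc. apply ceq_comp; [reflexivity|].
  rewrite (@conj_move 4 mids) by gate_compute.
  rewrite (@conj_gate 2 mids 0 2 0 1) by gate_compute. reflexivity.
Qed.

(** The control carries |0>. Swapping wires 2 and 3 puts the target next to it, where the three-wire
    fact [mid0_C3] applies. *)
Lemma zeros_C4 : zeros ;; C4 1 3 ≅ zeros.
Proof.
  assert (E : up (up sigma) ;; C4 1 2 ≅ C4 1 3 ;; up (up sigma)).
  { rewrite (@conj_move 4 (up (up sigma))) by gate_compute.
    rewrite (@conj_gate 2 (up (up sigma)) 1 2 1 3) by gate_compute. reflexivity. }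
  assert (F : zeros ;; up (up sigma) ;; C4 1 2 ≅ zeros ;; up (up sigma)).
  { assert (F1 : zeros ;; up (up sigma) ≅ up ket0 [*] (ket0 [*] c_id 1)).
    { rewrite up_up.
      etransitivity;
        [symmetry; apply (ceq_tens_comp (up ket0) (c_id 2) (c_id 1 [*] ket0) sigma)|].
      tens_congr; [apply ceq_comp_idr | apply (sigma_zero_r ket0)]. }
    assert (F2 : C4 1 2 ≅ C3 1 2 [*] c_id 1).
    { symmetry. transitivity (lift (c_id 4) (C3 1 2)).
      - unfold lift, pconj. simpl dag. symmetry.
        etransitivity; [apply ceq_comp_idr | apply ceq_comp_idl].
      - apply lift_gate; gate_compute. }
    assert (F3 : up ket0 [*] (ket0 [*] c_id 1) ≅ (up ket0 ;; mid0) [*] c_id 1).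
    { rewrite <- up_ket0_mid0.
      etransitivity; [symmetry; exact (tassoc (up ket0) ket0 (c_id 1))|].
      tens_congr; [|reflexivity]. unfold last0. rewrite (up_tens_id1 ket0).
      etransitivity; [apply (tens_split (up ket0) ket0)|].
      apply ceq_comp; [|reflexivity].
      exact (strict_eq (@tens_id0_cast 1 2 (up ket0) eq_refl eq_refl)). }
    rewrite F1, F2, F3.
    etransitivity; [symmetry; apply (tens_comp_l 1 (up ket0 ;; mid0) (C3 1 2))|].
    tens_congr; [|reflexivity]. rewrite ceq_comp_assoc, mid0_C3. reflexivity. }
  rewrite ceq_comp_assoc, E, <- ceq_comp_assoc in F.
  assert (K : up (up sigma) ;; up (up sigma) ≅ c_id 4).
  { rewrite <- !up_comp, (ceq_swapK 1 1), !up_id. reflexivity. }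
  rewrite <- (ceq_comp_idr (zeros ;; C4 1 3)), <- K, <- ceq_comp_assoc, F.
  rewrite ceq_comp_assoc, K. apply ceq_comp_idr.
Qed.

Lemma delta_tens_delta : delta [*] delta ≅ zeros ;; C4 0 1 ;; C4 2 3.
Proof.
  rewrite ceq_comp_assoc, <- cnot_tens_cnot. apply ceq_tens_comp.
Qed.

(** After [zeros] and before [mids], the left side is [C02 C01 C23] and the right side
    [C01 C23 C02 C13]. On the left, exchanging [C02] with [C23] creates a [C03]. On the right,
    moving [C13] to the front past [C01] creates the same [C03], and [zeros] then absorbs [C13]. *)
Lemma cnot_delta :
  cnot ;; ((delta [*] delta) ;; mids) ≅ (delta [*] delta) ;; mids ;; (cnot [*] cnot).
Proof.
  assert (E : mids ;; (cnot [*] cnot) ≅ C4 0 2 ;; C4 1 3 ;; mids).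
  { rewrite cnot_tens_cnot, (@conj_move 4 mids), conj_comp by gate_compute.
    rewrite (@conj_gate 2 mids 0 1 0 2), (@conj_gate 2 mids 2 3 1 3) by gate_compute.
    reflexivity. }
  rewrite (ceq_comp_assoc (delta [*] delta)), E, <- !ceq_comp_assoc.
  apply ceq_comp; [|reflexivity].
  rewrite !delta_tens_delta, <- !ceq_comp_assoc, cnot_zeros.
  transitivity (zeros ;; (C4 0 1 ;; C4 2 3 ;; C4 0 3 ;; C4 0 2)).
  - rewrite (ceq_comp_assoc zeros), <- C4_control012, !ceq_comp_assoc, C4_chain023.
    rewrite !ceq_comp_assoc. reflexivity.
  - symmetry. rewrite !ceq_comp_assoc, C4_disjoint0213.
    rewrite <- (ceq_comp_assoc (C4 2 3) (C4 1 3)), <- C4_target123.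
    rewrite <- !ceq_comp_assoc, (ceq_comp_assoc zeros (C4 0 1) (C4 1 3)), C4_chain013.
    rewrite <- !ceq_comp_assoc, zeros_C4.
    rewrite (ceq_comp_assoc zeros (C4 0 3) (C4 0 1)), <- C4_control013.
    rewrite !ceq_comp_assoc, <- (ceq_comp_assoc (C4 0 3) (C4 2 3)), C4_target023.
    rewrite !ceq_comp_assoc. reflexivity.
Qed.

(** * Copying all wires *)

(** In CNOT, [exch n m] is [ex4 n n m m]. Four independent arities make naturality expressible for
    arbitrary circuits and bring the inverse, [ex4 a b a' b'], into the same family. *)
Definition ex4 a a' b b' : circ ((a + a') + (b + b')) ((a + b) + (a' + b')) :=
  c_assoc a a' (b + b')
  ;; (c_id a [*] c_idto (Nat.add_assoc a' b b'))
  ;; (c_id a [*] (c_swap a' b [*] c_id b'))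
  ;; (c_id a [*] c_assoc b a' b')
  ;; c_idto (Nat.add_assoc a b (a' + b')).

Lemma isperm_ex4 a a' b b' : isperm (ex4 a a' b b').
Proof. repeat split; apply isperm_idto. Qed.

Lemma sem_ex4 a a' b b' i : sem (ex4 a a' b b') i =
  if i <? a then i else if i <? a + a' then i + b
  else if i <? a + a' + b then i - a' else i.
Proof.
  unfold ex4, c_assoc. cbn [sem]. rewrite !sem_idto. cases_nat; rewrite ?sem_idto; cases_nat.
Qed.

Ltac isperm_solve :=
  repeat lazymatch goal with
  | |- isperm (ex4 _ _ _ _) => apply isperm_ex4
  | |- isperm (c_idto _) => apply isperm_idto
  | |- isperm (c_assoc _ _ _) => apply isperm_idto
  | |- isperm (_ ;; _) => split
  | |- isperm (_ [*] _) => split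
  | |- isperm _ => exact I
  end.

(* The implicit indices of [sem] may only be convertible to those of the lemmas. *)
Ltac sem_simpl :=
  repeat match goal with
  | |- context [@sem ?n ?m (ex4 ?a ?b ?c ?d) ?i] =>
    change (@sem n m (ex4 a b c d) i) with (sem (ex4 a b c d) i); rewrite sem_ex4
  | |- context [@sem ?n ?m (c_idto ?e) ?i] =>
    change (@sem n m (c_idto e) i) with (sem (c_idto e) i); rewrite sem_idto
  end.

Ltac perm_solve :=
  apply perm_coherence;
  [ isperm_solve
  | isperm_solve
  | let i := fresh "i" in intros i ?; unfold c_assoc; cbn [sem];
    sem_simpl; cases_nat ].

Lemma dag_ex4 a a' b b' : dag (ex4 a a' b b') ≅ ex4 a b a' b'.
Proof.
  apply perm_coherence.
  - apply isperm_dag, isperm_ex4.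
  - apply isperm_ex4.
  - intros i Hi. rewrite sem_ex4. unfold ex4, c_assoc. cbn [dag sem].
    rewrite !dag_idto, !sem_idto. cases_nat; rewrite ?sem_idto; cases_nat.
Qed.

Lemma ex4K a a' b b' : ex4 a a' b b' ;; ex4 a b a' b' ≅ c_id _.
Proof. rewrite <- (dag_ex4 a a' b b'). apply perm_dagK, isperm_ex4. Qed.

Lemma associ_nat n m p n' m' p' (f : circ n n') (g : circ m m') (h : circ p p') :
  (f [*] (g [*] h)) ;; c_idto (Nat.add_assoc n' m' p')
  ≅ c_idto (Nat.add_assoc n m p) ;; (f [*] g [*] h).
Proof.
  pose proof (move_casts (ceq_assoc f g h)) as H.
  rewrite !eq_sym_involutive in H. symmetry. exact H.
Qed.

Lemma ex4_nat a a' b b' c c' d d'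
    (f : circ a c) (f' : circ a' c') (g : circ b d) (g' : circ b' d') :
  ((f [*] f') [*] (g [*] g')) ;; ex4 c c' d d' ≅
  ex4 a a' b b' ;; ((f [*] g) [*] (f' [*] g')).
Proof.
  assert (M : forall x y y' z z' (h : circ x c) (u : circ y y') (v : circ z z')
    (s : circ y z) (s' : circ y' z'), u ;; s' ≅ s ;; v ->
    (h [*] u) ;; (c_id c [*] s') ≅ (c_id x [*] s) ;; (h [*] v)).
  { intros x y y' z z' h u v s s' E.
    rewrite <- !ceq_tens_comp, E, ceq_comp_idl, ceq_comp_idr. reflexivity. }
  unfold ex4. rewrite <- !ceq_comp_assoc, ceq_assoc.
  rewrite !(ceq_comp_assoc (c_assoc a a' (b + b'))).
  rewrite (M _ _ _ _ _ f _ _ _ _ (associ_nat f' g g')).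
  rewrite !ceq_comp_assoc. do 2 (apply ceq_comp; [reflexivity|]).
  rewrite <- !ceq_comp_assoc.
  assert (E : ((f' [*] g) [*] g') ;; (c_swap c' d [*] c_id d') ≅
              (c_swap a' b [*] c_id b') ;; ((g [*] f') [*] g')).
  { rewrite <- !ceq_tens_comp, ceq_swap_nat, ceq_comp_idl, ceq_comp_idr. reflexivity. }
  rewrite (M _ _ _ _ _ f _ _ _ _ E).
  rewrite !ceq_comp_assoc. apply ceq_comp; [reflexivity|].
  rewrite <- !ceq_comp_assoc.
  rewrite (M _ _ _ _ _ f _ _ _ _ (ceq_assoc g f' g')).
  rewrite !ceq_comp_assoc. apply ceq_comp; [reflexivity|].
  apply associ_nat.
Qed.

Fixpoint copy (n : nat) : circ n (n + n) :=
  match n with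
  | 0 => c_id 0
  | S k => (delta [*] copy k) ;; ex4 1 1 k k
  end.

Lemma copy_uniform n m : copy (n + m) ≅ (copy n [*] copy m) ;; ex4 n n m m.
Proof.
  induction n as [|n IH]; simpl copy.
  - etransitivity; [symmetry; apply ceq_comp_idr|].
    apply ceq_comp; [symmetry; apply ceq_lunit|].
    perm_solve.
  - transitivity ((delta [*] (copy n [*] copy m)) ;; (c_id 2 [*] ex4 n n m m)
        ;; ex4 1 1 (n + m) (n + m)).
    + apply ceq_comp; [|reflexivity].
      etransitivity; [exact (ceq_tens (ceq_refl delta) IH)|].
      etransitivity; [exact (ceq_tens (symmetry (ceq_comp_idr delta)) (ceq_refl _))|].
      apply (ceq_tens_comp delta (c_id 2) (copy n [*] copy m) (ex4 n n m m)).
    + transitivity (((delta [*] copy n) [*] copy m) ;; (ex4 1 1 n n [*] c_id (m + m))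
        ;; ex4 (S n) (S n) m m).
      2:{ apply ceq_comp; [|reflexivity].
          etransitivity;
            [symmetry; apply (ceq_tens_comp (delta [*] copy n) (ex4 1 1 n n) (copy m) (c_id (m + m)))|].
          tens_congr; [reflexivity | apply ceq_comp_idr]. }
      etransitivity; [apply ceq_comp_assoc|]. etransitivity; [|symmetry; apply ceq_comp_assoc].
      apply ceq_comp; [symmetry; exact (tassoc delta (copy n) (copy m))|].
      perm_solve.
Qed.

Lemma copy_total n : copy n ;; dag (copy n) ≅ c_id n.
Proof.
  induction n as [|n IH].
  - apply ceq_comp_idl.
  - change ((delta [*] copy n) ;; ex4 1 1 n n ;; (dag (ex4 1 1 n n) ;; (dag delta [*] dag (copy n)))
      ≅ c_id (S n)).
    rewrite ceq_comp_assoc, <- (ceq_comp_assoc (ex4 1 1 n n)).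
    rewrite (perm_dagK (isperm_ex4 1 1 n n)), ceq_comp_idl, <- ceq_tens_comp.
    rewrite delta_total, IH. apply (ceq_tens_id 1 n).
Qed.

Lemma copy_cocomm n : copy n ;; c_swap n n ≅ copy n.
Proof.
  induction n as [|n IH].
  - etransitivity; [apply ceq_comp_idl|]. perm_solve.
  - simpl copy.
    transitivity ((delta [*] copy n) ;; (sigma [*] c_swap n n) ;; ex4 1 1 n n).
    + etransitivity; [apply ceq_comp_assoc|]. etransitivity; [|symmetry; apply ceq_comp_assoc].
      apply ceq_comp; [reflexivity|]. unfold sigma. perm_solve.
    + apply ceq_comp; [|reflexivity].
      rewrite <- ceq_tens_comp, delta_cocomm, IH. reflexivity.
Qed.

(** Naturality of [ex4] gathers all copying of the first wire beside all copying of the other [n],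
    so each side is a tensor of two smaller composites followed by a rewiring. [delta_coassoc] and
    the induction hypothesis act on the factors, and coherence compares the rewirings. *)
Lemma copy_coassoc n :
  copy n ;; (c_id n [*] copy n) ≅ copy n ;; (copy n [*] c_id n) ;; c_assoc n n n.
Proof.
  induction n as [|n IH].
  - simpl copy. etransitivity; [apply ceq_comp_idl|].
    etransitivity; [|apply ceq_comp; [symmetry; apply ceq_comp_idl | reflexivity]].
    perm_solve.
  - simpl copy. set (D := copy n) in *.
    transitivity (((delta ;; (c_id 1 [*] delta)) [*] (D ;; (c_id n [*] D)))
      ;; (ex4 1 2 n (n + n) ;; (c_id (S n) [*] ex4 1 1 n n))).
    + rewrite ceq_tens_comp, !ceq_comp_assoc. apply ceq_comp; [reflexivity|].
      etransitivity;
        [apply ceq_comp; [reflexivity | apply (tens_comp_r (S n) (delta [*] D) (ex4 1 1 n n))]|].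
      etransitivity; [symmetry; apply ceq_comp_assoc|].
      etransitivity; [|apply ceq_comp_assoc].
      apply ceq_comp; [|reflexivity].
      etransitivity; [|symmetry; apply (ex4_nat (c_id 1) delta (c_id n) D)].
      apply ceq_comp; [reflexivity|]. tens_congr; [|reflexivity].
      symmetry; apply (ceq_tens_id 1 n).
    + rewrite delta_coassoc, IH.
      transitivity (((delta ;; (delta [*] c_id 1)) [*] (D ;; (D [*] c_id n)))
        ;; (c_id 3 [*] c_assoc n n n)
        ;; (ex4 1 2 n (n + n) ;; (c_id (S n) [*] ex4 1 1 n n))).
      { apply ceq_comp; [|reflexivity].
        etransitivity;
          [|apply (ceq_tens_comp (delta ;; (delta [*] c_id 1)) (c_id 3)
              (D ;; (D [*] c_id n)) (c_assoc n n n))].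
        tens_congr; [symmetry; apply ceq_comp_idr | reflexivity]. }
      transitivity (((delta ;; (delta [*] c_id 1)) [*] (D ;; (D [*] c_id n)))
        ;; (ex4 2 1 (n + n) n ;; (ex4 1 1 n n [*] c_id (S n)) ;; c_assoc (S n) (S n) (S n))).
      { etransitivity; [apply ceq_comp_assoc|]. apply ceq_comp; [reflexivity|]. perm_solve. }
      etransitivity; [symmetry; apply ceq_comp_assoc|].
      apply ceq_comp; [|reflexivity].
      rewrite ceq_tens_comp, !ceq_comp_assoc. apply ceq_comp; [reflexivity|].
      etransitivity;
        [|apply ceq_comp;
           [reflexivity | symmetry; apply (tens_comp_l (S n) (delta [*] D) (ex4 1 1 n n))]].
      etransitivity; [symmetry; apply ceq_comp_assoc|].
      etransitivity; [|apply ceq_comp_assoc].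
      apply ceq_comp; [|reflexivity].
      etransitivity; [apply (ex4_nat delta (c_id 1) D (c_id n))|].
      apply ceq_comp; [reflexivity|]. tens_congr; [reflexivity|].
      apply (ceq_tens_id 1 n).
Qed.

(** Same separation of the first wire, but with rewirings at both ends: [EX] and [EY] pull them out
    of the copying and merging layers, and coherence collapses what lies between [X] and [Y]. *)
Lemma copy_frob n :
  (copy n [*] c_id n) ;; c_assoc n n n ;; (c_id n [*] dag (copy n)) ≅ dag (copy n) ;; copy n.
Proof.
  induction n as [|n IH].
  - simpl copy. simpl dag. symmetry. etransitivity; [apply ceq_comp_idl|]. perm_solve.
  - simpl copy. set (D := copy n) in *.
    change (dag ((delta [*] D) ;; ex4 1 1 n n))
      with (dag (ex4 1 1 n n) ;; (dag delta [*] dag D)).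
    set (X := (delta [*] c_id 1) [*] (D [*] c_id n)).
    set (Y := (c_id (S n)) [*] (dag delta [*] dag D)).
    assert (EY : ((c_id 1 [*] dag delta) [*] (c_id n [*] dag D)) ;; ex4 1 1 n n ≅
                 ex4 1 2 n (n + n) ;; Y).
    { etransitivity; [apply (ex4_nat (c_id 1) (dag delta) (c_id n) (dag D))|].
      apply ceq_comp; [reflexivity|]. unfold Y. tens_congr; [|reflexivity]. apply (ceq_tens_id 1 n). }
    assert (EX : (delta [*] D) [*] c_id (S n) ≅ ex4 1 n 1 n ;; (X ;; ex4 2 1 (n + n) n)).
    { unfold X. rewrite (ex4_nat delta (c_id 1) D (c_id n)).
      etransitivity; [|apply ceq_comp_assoc].
      rewrite ex4K, ceq_comp_idl. tens_congr; [reflexivity|].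
      symmetry; apply (ceq_tens_id 1 n). }
    transitivity (ex4 1 n 1 n ;; X ;; (c_id 3 [*] c_assoc n n n) ;; ex4 1 2 n (n + n) ;; Y).
    + transitivity (ex4 1 n 1 n ;; X ;;
        (ex4 2 1 (n + n) n ;; (ex4 1 1 n n [*] c_id (S n)) ;; c_assoc (S n) (S n) (S n)
         ;; (c_id (S n) [*] ex4 1 n 1 n)) ;; Y).
      * etransitivity;
          [apply ceq_comp;
            [apply ceq_comp;
              [apply (tens_comp_l (S n) (delta [*] D) (ex4 1 1 n n)) | reflexivity]|]|].
        { etransitivity; [apply (tens_comp_r (S n) (dag (ex4 1 1 n n)) (dag delta [*] dag D))|].
          apply ceq_comp; [|reflexivity].
          exact (ceq_tens (ceq_refl (c_id (S n))) (dag_ex4 1 1 n n)). }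
        etransitivity;
          [do 3 (apply ceq_comp; [|reflexivity]); exact EX|].
        rewrite !ceq_comp_assoc. reflexivity.
      * apply ceq_comp; [|reflexivity]. rewrite !ceq_comp_assoc.
        do 2 (apply ceq_comp; [reflexivity|]). perm_solve.
    + rewrite !ceq_comp_assoc. rewrite <- EY.
      etransitivity; [|apply ceq_comp; [symmetry; apply (dag_ex4 1 1 n n)|reflexivity]].
      apply ceq_comp; [reflexivity|].
      rewrite <- !ceq_comp_assoc. apply ceq_comp; [|reflexivity].
      symmetry.
      etransitivity; [symmetry; apply (ceq_tens_comp (dag delta) delta (dag D) D)|].
      etransitivity; [exact (ceq_tens (ceq_sym delta_frob) (ceq_sym IH))|].
      etransitivity; [apply (ceq_tens_comp (delta [*] c_id 1) (c_id 1 [*] dag delta)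
        ((D [*] c_id n) ;; c_assoc n n n) (c_id n [*] dag D))|].
      apply ceq_comp; [|reflexivity].
      etransitivity; [|apply (ceq_tens_comp (delta [*] c_id 1) (c_id 3)
        (D [*] c_id n) (c_assoc n n n))].
      tens_congr; [symmetry; apply ceq_comp_idr | reflexivity].
Qed.

Lemma copy_one : copy 1 ≅ delta.
Proof.
  simpl copy. etransitivity; [|apply ceq_comp_idr].
  apply ceq_comp.
  - exact (strict_eq (@tens_id0_cast 1 2 delta eq_refl eq_refl)).
  - perm_solve.
Qed.

Lemma copy_two : copy 2 ≅ (delta [*] delta) ;; mids.
Proof.
  change (copy 2) with ((delta [*] copy 1) ;; ex4 1 1 1 1).
  apply ceq_comp.
  - exact (ceq_tens (ceq_refl delta) copy_one).
  - unfold mids, up, sw, sigma. perm_solve.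
Qed.

(** * Naturality and the graph equation *)

Lemma copy_nat n m (f : circ n m) : f ;; copy m ≅ copy n ;; (f [*] f).
Proof.
  induction f.
  - rewrite ceq_comp_idl, ceq_tens_id, ceq_comp_idr. reflexivity.
  - rewrite ceq_comp_assoc, IHf2, <- ceq_comp_assoc, IHf1, ceq_comp_assoc, <- ceq_tens_comp.
    reflexivity.
  - rewrite !copy_uniform, <- ceq_comp_assoc, <- ceq_tens_comp, IHf1, IHf2, ceq_tens_comp.
    rewrite !ceq_comp_assoc, ex4_nat. reflexivity.
  - rewrite !copy_uniform, <- ceq_comp_assoc, <- ceq_swap_nat, !ceq_comp_assoc.
    apply ceq_comp; [reflexivity|]. perm_solve.
  - rewrite copy_two. apply cnot_delta.
  - rewrite copy_one, ket1_delta. symmetry. apply ceq_comp_idl.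
  - rewrite copy_one.
    (* CNT.6 inserts [ket1 ;; bra1], so that [delta_bra1] can trade [bra1 ;; ket1] for a copy with
       one branch tested. *)
    transitivity (bra1 ;; (ket1 ;; bra1)).
    + rewrite (ceq_rel CNT6). reflexivity.
    + rewrite <- ceq_comp_assoc, <- delta_bra1, ceq_comp_assoc.
      apply ceq_comp; [reflexivity|]. symmetry.
      etransitivity; [apply (tens_split bra1 bra1)|].
      apply ceq_comp; [reflexivity | apply ceq_lunit].
Qed.

(** If [u ;; dag u] is an identity, naturality suffices, because [dag u] undoes the second copy of
    [u]. For [bra1] the equation is [delta_bra1]. In a composite, [dag f1] on one branch slides past
    [f2] on the other. *)
Lemma copy_graph n m (f : circ n m) :
  copy n ;; (f [*] c_id n) ≅ f ;; copy m ;; (c_id m [*] dag f).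
Proof.
  assert (iso : forall n m (u : circ n m), u ;; dag u ≅ c_id n ->
    copy n ;; (u [*] c_id n) ≅ u ;; copy m ;; (c_id m [*] dag u)).
  { intros n' m' u H. rewrite copy_nat, ceq_comp_assoc, <- ceq_tens_comp, H, ceq_comp_idr.
    reflexivity. }
  induction f.
  - apply iso, ceq_comp_idl.
  - simpl dag. rewrite tens_comp_l, tens_comp_r, <- ceq_comp_assoc, IHf1.
    rewrite (ceq_comp_assoc (f1 ;; copy m)), <- tens_interchange.
    rewrite (ceq_comp_assoc f1 (copy m)), <- (ceq_comp_assoc (copy m)), IHf2.
    rewrite !ceq_comp_assoc. reflexivity.
  - simpl dag. rewrite !copy_uniform.
    rewrite <- (ceq_tens_id n m), <- (ceq_tens_id n' m').
    rewrite !ceq_comp_assoc, <- !ex4_nat, <- !ceq_comp_assoc.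
    apply ceq_comp; [|reflexivity].
    rewrite <- !ceq_tens_comp, IHf1, IHf2. reflexivity.
  - apply iso, ceq_swapK.
  - apply iso, cnot_cnot.
  - simpl copy at 1. etransitivity; [apply ceq_comp_idl|].
    rewrite copy_one, ket1_delta. symmetry.
    etransitivity; [symmetry; apply (ceq_tens_comp ket1 (c_id 1) ket1 bra1)|].
    exact (ceq_tens (ceq_comp_idr ket1) (ceq_rel CNT6)).
  - rewrite copy_one, delta_bra1. simpl. rewrite ceq_comp_idr.
    apply ceq_comp; [reflexivity|]. symmetry. apply ceq_lunit.
Qed.

Lemma copy_mono n m (f g : circ n m) : f ;; copy m ≅ g ;; copy m -> f ≅ g.
Proof.
  intro H. rewrite <- (ceq_comp_idr f), <- (ceq_comp_idr g), <- (copy_total m).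
  rewrite <- !ceq_comp_assoc, H. reflexivity.
Qed.

Lemma copy_flip n m (f : circ n m) :
  copy n ;; (c_id n [*] f) ≅ copy n ;; (f [*] c_id n) ;; c_swap m n.
Proof.
  rewrite ceq_comp_assoc, ceq_swap_nat, <- ceq_comp_assoc, copy_cocomm. reflexivity.
Qed.

Lemma comp_dag_comp n m (f : circ n m) : f ;; dag f ;; f ≅ f.
Proof.
  assert (H : copy m ;; (c_id m [*] dag f) ≅ dag f ;; copy n ;; (f [*] c_id n)).
  { rewrite copy_flip, (copy_graph (dag f)), dag_dag, ceq_comp_assoc, ceq_swap_nat.
    rewrite <- ceq_comp_assoc, (ceq_comp_assoc (dag f)), copy_cocomm. reflexivity. }
  (* [Q] now says that [f ;; dag f] may be put in front of [copy n ;; (f [*] c_id n)]; applying [f]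
     on the second branch as well turns the latter into [f ;; copy m]. *)
  pose proof (copy_graph f) as Q. rewrite (ceq_comp_assoc f), H in Q.
  apply copy_mono. rewrite (ceq_comp_assoc (f ;; dag f)), copy_nat.
  rewrite (tens_split f f) at 2. rewrite <- (ceq_comp_assoc (copy n)), Q.
  rewrite (tens_split f f), !ceq_comp_assoc. reflexivity.
Qed.

(** The graph equation of [e] together with naturality puts [e] on the first branch and [e ;; dag e]
    on the second, and the latter is [e] by [comp_dag_comp]. *)
Lemma copy_idem n m (f : circ n m) : let e := f ;; dag f in
  copy n ;; (e [*] c_id n) ≅ e ;; copy n.
Proof.
  intro e. rewrite copy_graph, copy_nat, ceq_comp_assoc, <- ceq_tens_comp, ceq_comp_idr.
  unfold e. simpl dag. rewrite dag_dag, <- (ceq_comp_assoc (f ;; dag f) f), comp_dag_comp.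
  reflexivity.
Qed.

Lemma copy_idem_r n m (f : circ n m) : let e := f ;; dag f in
  copy n ;; (c_id n [*] e) ≅ e ;; copy n.
Proof.
  intro e. rewrite copy_flip. unfold e. rewrite copy_idem, ceq_comp_assoc, copy_cocomm. reflexivity.
Qed.

(** Placed on different branches of a copy, the two idempotents commute by the interchange law. *)
Lemma idem_comm n m p (f : circ n m) (g : circ n p) :
  (f ;; dag f) ;; (g ;; dag g) ≅ (g ;; dag g) ;; (f ;; dag f).
Proof.
  apply copy_mono.
  rewrite (ceq_comp_assoc _ (g ;; dag g)), <- copy_idem_r, <- ceq_comp_assoc, <- copy_idem.
  rewrite (ceq_comp_assoc _ (f ;; dag f)), <- copy_idem, <- ceq_comp_assoc, <- copy_idem_r.
  rewrite !(ceq_comp_assoc (copy n)), tens_interchange. reflexivity.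
Qed.

(** * The discrete inverse structure *)

Definition CNOT_restriction : RestrictionStructure CNOT.
Proof.
  refine {| restr := fun (A B : CNOT) (f : Hom A B) => (f ;; dag f : circ A A) |}; simpl.
  - intros A B f g H. simpl in *. rewrite H. reflexivity.
  - intros A B f. apply comp_dag_comp.
  - intros A B D f g. apply idem_comm.
  - intros A B D f g. simpl. rewrite dag_dag.
    rewrite (ceq_comp_assoc (g ;; dag g) f), <- (ceq_comp_assoc f (dag f)).
    rewrite (idem_comm f g), <- (ceq_comp_assoc (g ;; dag g) (g ;; dag g)).
    rewrite <- (ceq_comp_assoc (g ;; dag g) g), comp_dag_comp. reflexivity.
  - intros A B D f g. simpl.
    rewrite !ceq_comp_assoc.
    (* The range idempotent [dag f ;; f] is the domain idempotent of [dag f], so it commutes with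
       [g ;; dag g]. *)
    pose proof (idem_comm g (dag f)) as H. rewrite dag_dag in H.
    rewrite !ceq_comp_assoc in H. rewrite H, <- !ceq_comp_assoc, comp_dag_comp. reflexivity.
(* Left transparent so that [restr] computes to [f ;; dag f] below. *)
Defined.

Lemma dag_partial_inverse (A B : CNOT) (f : Hom A B) :
  is_partial_inverse CNOT_restriction f (dag f).
Proof. split; simpl; [|rewrite dag_dag]; reflexivity. Qed.

Definition CNOT_inverse : InverseStructure CNOT := {|
  inv_restr := CNOT_restriction;
  pinv := fun A B : CNOT => @dag A B;
  pinv_proper := dag_proper;
  pinvP := dag_partial_inverse
|}.

Theorem mainTheorem2 : is_discrete_inverse_category CNOT.
Proof.
  exists CNOT_inverse. split.
  - intros A B A' B' f g. reflexivity.
  - exists copy. split; simpl.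
    + exact copy_total.
    + exact copy_nat.
    + exact copy_cocomm.
    + exact copy_coassoc.
    + exact copy_frob.
    (* The right Frobenius law is the mirror image of the left one. *)
    + intro n. pose proof (dag_ceq (copy_frob n)) as H. simpl dag in H.
      rewrite dag_dag in H. symmetry. rewrite ceq_comp_assoc. exact H.
    + exact copy_uniform.
Qed.
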